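(* For integers $i,j\ge0$ let $\boldsymbol A=(A_1,\dots,A_i)\in(\mathbb R\setminus[0,1))^i$ and $\boldsymbol B=(B_1,\dots,B_j)\in(\mathbb R\setminus\{0\})^j$. Let $\mathfrak p=(p_m)_{m\ge1}$ be a sequence of polynomials of the form $$p_m=\operatorname{Dil}_{\sqrt{m^{i-j}}}\ \mathcal H_m^E\left[\begin{smallmatrix}\boldsymbol b_m\\ \boldsymbol a_m\end{smallmatrix}\right]\in\mathcal P_{2m}^E(\mathbb R),$$ where the tuples of parameters $\boldsymbol a_m\in\mathbb R^i$ and $\boldsymbol b_m\in\mathbb R^j$ satisfy $\lim_{m\to\infty}\boldsymbol a_m=\boldsymbol A$ and $\lim_{m\to\infty}\boldsymbol b_m=\boldsymbol B$. Then $\mathfrak p$ is a converging sequence: the empirical root distributions $\rho(p_m)$ converge weakly, as $m\to\infty$, to the measure $\rho^E\left[\begin{smallmatrix}B_1,\dots,B_j\\ A_1,\dots,A_i\end{smallmatrix}\right]$, which is a symmetric probability measure on $\mathbb R$.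
   Context: $\mathcal P_n$ is the set of monic polynomials of degree $n$ over $\mathbb C$; $\mathcal P_{2m}^E(\mathbb R)$ is the set of even polynomials ($p(-x)=p(x)$) in $\mathcal P_{2m}$ with all roots real. Coefficients $\mathsf e_k(p)$ of $p\in\mathcal P_n$ are defined by $p(x)=\sum_{k=0}^nx^{n-k}(-1)^k\mathsf e_k(p)$. For $\alpha\neq0$, $[\operatorname{Dil}_\alpha p](x)=\alpha^np(\alpha^{-1}x)$. With $(a)^{\underline k}=a(a-1)\cdots(a-k+1)$: for real tuples $\boldsymbol b=(b_1,\dots,b_j)$ and $\boldsymbol a=(a_1,\dots,a_i)$ with no entry of $\boldsymbol a$ in $\{0,\frac1m,\dots,\frac{m-1}m\}$ (this is part of the assumption that the polynomials are defined), $\mathcal H_m\left[\begin{smallmatrix}\boldsymbol b\\ \boldsymbol a\end{smallmatrix}\right]\in\mathcal P_m$ is the monic polynomial with $\mathsf e_k=\binom mk\frac{\prod_t(mb_t)^{\underline k}}{\prod_s(ma_s)^{\underline k}}$, $0\le k\le m$, and $\mathcal H_m^E\left[\begin{smallmatrix}\boldsymbol b\\ \boldsymbol a\end{smallmatrix}\right](x)=\mathcal H_m\left[\begin{smallmatrix}\boldsymbol b\\ \boldsymbol a\end{smallmatrix}\right](x^2)$. The empirical root distribution of $p$ is $\rho(p)=\frac1{\deg p}\sum_{\alpha\text{ root of }p}\delta_\alpha$ (roots with multiplicity). $S$-transform: for a compactly supported probability measure $\mu$ on $[0,\infty)$ with moments $m_k$, $m_1\ne0$, put $M_\mu(z)=\sum_{k\ge1}m_kz^k$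 and $S_\mu(z)=\frac{z+1}zM_\mu^{\langle-1\rangle}(z)$ near $z=0$, where $\langle-1\rangle$ denotes compositional inverse; $S_\mu$ determines $\mu$. $\rho\left[\begin{smallmatrix}B_1,\dots,B_j\\ A_1,\dots,A_i\end{smallmatrix}\right]$ denotes the probability measure on $[0,\infty)$ whose $S$-transform is $\frac{\prod_{r=1}^i(z+A_r)}{\prod_{s=1}^j(z+B_s)}$ (its existence under the stated assumptions is understood), and $\rho^E\left[\begin{smallmatrix}B_1,\dots,B_j\\ A_1,\dots,A_i\end{smallmatrix}\right]=S\left(\rho\left[\begin{smallmatrix}B_1,\dots,B_j\\ A_1,\dots,A_i\end{smallmatrix}\right]\right)$, where for a probability measure $\nu$ on $[0,\infty)$, $S(\nu)=\frac12(S_+(\nu)+S_-(\nu))$ with $S_\pm(\nu)$ the pushforwards of $\nu$ under $t\mapsto\pm\sqrt t$. *)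

(* Defs.v *)
From HB Require Import structures.
From mathcomp Require Import all_boot all_order all_algebra.
From mathcomp Require Import complex.
From mathcomp Require Import all_classical all_reals all_analysis.
From mathcomp Require Import measurable_realfun.

Set Implicit Arguments.
Unset Strict Implicit.
Unset Printing Implicit Defensive.

Import Order.TTheory GRing.Theory Num.Theory.
Import numFieldNormedType.Exports.

Local Open Scope classical_set_scope.
Local Open Scope complex_scope.
Local Open Scope ring_scope.

Section polynomials.
Variable R : realType.
Implicit Types (m n k i j : nat) (p : {poly R[i]}).

Definition ecoef p k : R[i] := (-1) ^+ k * p`_((size p).-1 - k).

Definition dil (alpha : R[i]) p : {poly R[i]} :=
  alpha ^+ (size p).-1 *: (p \Po (alpha^-1 *: 'X)).

Definition even_real_rooted n p : Prop :=
  [/\ p \is monic, size p = n.+1, p \Po (- 'X) = p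
    & forall z, root p z -> complex.Im z = 0].

Definition falling (x : R) k : R := \prod_(l < k) (x - l%:R).

Definition hyp_coef m j (b : 'I_j -> R) i (a : 'I_i -> R) k : R :=
  'C(m, k)%:R * ((\prod_(t < j) falling (m%:R * b t) k)
               / \prod_(s < i) falling (m%:R * a s) k).

Definition hyp_poly m j (b : 'I_j -> R) i (a : 'I_i -> R) : {poly R[i]} :=
  \poly_(l < m.+1) ((-1) ^+ (m - l) * (hyp_coef m b a (m - l))%:C).

Definition hyp_even_poly m j (b : 'I_j -> R) i (a : 'I_i -> R) : {poly R[i]} :=
  hyp_poly m b a \Po 'X^2.

(* hyp_poly m b a is well defined only under this condition (0^-1 = 0). *)
Definition admissible m i (a : 'I_i -> R) : Prop :=
  forall s k, (k < m)%N -> a s <> k%:R / m%:R.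

Lemma hyp_coef0 m j (b : 'I_j -> R) i (a : 'I_i -> R) : hyp_coef m b a 0 = 1.
Proof.
by rewrite /hyp_coef bin0 !big1 ?divr1 ?mulr1// => s _; rewrite /falling big_ord0.
Qed.

Lemma size_hyp_poly m j (b : 'I_j -> R) i (a : 'I_i -> R) :
  size (hyp_poly m b a) = m.+1.
Proof. by rewrite size_poly_eq//= subnn hyp_coef0 mulr1 oner_neq0. Qed.

Lemma hyp_poly_monic m j (b : 'I_j -> R) i (a : 'I_i -> R) :
  hyp_poly m b a \is monic.
Proof.
by rewrite monicE /lead_coef size_hyp_poly coef_poly ltnSn subnn hyp_coef0 mulr1.
Qed.

Lemma ecoef_hyp_poly m j (b : 'I_j -> R) i (a : 'I_i -> R) k : (k <= m)%N ->
  ecoef (hyp_poly m b a) k = (hyp_coef m b a k)%:C.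
Proof.
move=> km; rewrite /ecoef size_hyp_poly coef_poly ltnS leq_subr/= subKn//.
by rewrite mulrA -exprD addnn -mul2n exprM sqrrN expr1n expr1n mul1r.
Qed.

(* The complex roots of p, with multiplicity. *)
Definition poly_roots p : seq R[i] := sval (closed_field_poly_normal p).

(* A measure on the real line; meant for p with only real roots, so that
   complex.Re is just the identification of real complex numbers with R. *)
Definition root_distr p : {measure set R -> \bar R} :=
  mscale ((size p).-1%:R^-1)%:nng
    (msum (fun l => \d_(complex.Re (poly_roots p)`_l)) (size (poly_roots p))).

End polynomials.

Section measures.
Variable R : realType.
Implicit Types (mu nu : probability R R).

Definition weak_cvg (mu_ : nat -> {measure set R -> \bar R})
    (mu : {measure set R -> \bar R}) : Prop :=
  forall f : R -> R, continuous f -> (exists K : R, forall x, `|f x| <= K) ->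
    (\int[mu_ n]_x (f x)%:E)%E @[n --> \oo] --> (\int[mu]_x (f x)%:E)%E.

Definition symmetric_probability (mu : {measure set R -> \bar R}) : Prop :=
  mu setT = 1%E /\
  forall A : set R, measurable A -> mu ((fun x => - x) @^-1` A) = mu A.

Definition moment mu k : R := \int[mu]_x (x ^+ k).

Definition moment_series mu (z : R) : R :=
  limn [series moment mu k.+1 * z ^+ k.+1]_k.

(* g is the compositional inverse of f, as germs at 0. *)
Definition inverse_near0 (f g : R -> R) : Prop :=
  [/\ {for 0, continuous g}, \forall z \near 0, f (g z) = z
    & \forall z \near 0, g (f z) = z].

(* The S-transform is a germ at 0, taken here in the real variable z;
   the moments are real, so this is the same as the germ over the complexes. *)
Definition has_S_transform mu (S : R -> R) : Prop :=
  exists2 chi, inverse_near0 (moment_series mu) chi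
    & \forall z \near 0^', S z = (z + 1) / z * chi z.

Definition is_rho j (B : 'I_j -> R) i (A : 'I_i -> R) mu : Prop :=
  [/\ exists K : R, mu `[0, K]%classic = 1%E,
      moment mu 1 <> 0
    & has_S_transform mu
        (fun z => (\prod_(r < i) (z + A r)) / \prod_(s < j) (z + B s))].

Definition sqrt_pos (t : R) : R := Num.sqrt t.
Definition sqrt_neg (t : R) : R := - Num.sqrt t.

Lemma measurable_sqrt_pos : measurable_fun setT sqrt_pos.
Proof. by apply: continuous_measurable_fun; exact: sqrt_continuous. Qed.

Lemma measurable_sqrt_neg : measurable_fun setT sqrt_neg.
Proof.
by apply: continuous_measurable_fun => x; apply: cvgN; exact: sqrt_continuous.
Qed.

HB.instance Definition _ :=
  isMeasurableFun.Build _ _ _ _ sqrt_pos measurable_sqrt_pos.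
HB.instance Definition _ :=
  isMeasurableFun.Build _ _ _ _ sqrt_neg measurable_sqrt_neg.

(* S(nu); [distribution nu f] is the pushforward of nu under f. *)
Definition symmetrization nu : {measure set R -> \bar R} :=
  mscale (2^-1)%:nng
    (measure_add (distribution nu sqrt_pos) (distribution nu sqrt_neg)).

End measures.

(* Main.v *)
Require Import Defs.
From mathcomp Require Import all_boot all_order all_algebra.
From mathcomp Require Import complex.
From mathcomp Require Import all_classical all_reals all_analysis.
From mathcomp Require Import measurable_realfun.
From mathcomp Require Import ring lra.

Set Implicit Arguments.
Unset Strict Implicit.
Unset Printing Implicit Defensive.

Import Order.TTheory GRing.Theory Num.Theory.
Import numFieldNormedType.Exports.

Local Open Scope classical_set_scope.
Local Open Scope complex_scope.
Local Open Scope ring_scope.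

(** Write p_m(x) = Q_m(x^2), so that Q_m is a dilated hypergeometric polynomial
    all of whose roots are real and nonnegative. The statement is proved by the
    method of moments, applied to the empirical root distributions of the Q_m.

    The coefficients of the reversed polynomial P of Q_m satisfy a two-term
    recurrence, that is, with D = (1/m) X d/dX,
      D prod_r (a_r + 1/m - D) P = - X (1 - D) prod_s (b_s - D) P.
    Moreover D P = - M_m P, where M_m = sum_(k >= 1) mom_k X^k is the moment
    series of the root distribution (Newton's identities). Conjugating by P
    turns D into D - M_m, so M_m solves a differential equation of Riccati type
    ([hypergeometric_riccati]). As m tends to infinity the derivatives carry a
    factor 1/m and disappear; comparing coefficients of X^n shows by induction
    on n that the moments converge, the factor in front of the top moment having
    the nonzero limit prod_r A_r. The limit series T solves the algebraic
    equation T prod_r (A_r + T) = X (1 + T) prod_s (B_s + T) ([moments_cvg]).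

    This equation says exactly that T is the local inverse at 0 of
    z / (z + 1) * prod_r (z + A_r) / prod_s (z + B_s), that is, T has the required
    S-transform. A majorant argument gives a positive radius of convergence
    ([gseries_bounded]); the function T then solves the equation
    ([gsum_equation]), and it is onto a neighbourhood of 0 by the intermediate
    value theorem because its first coefficient is positive, so that it is
    indeed a two-sided inverse ([gsum_inverse]).

    The limit measure exists because the truncated root distributions have
    quantile functions which converge pointwise along an ultrafilter, and
    Riemann sums of monotone functions converge at a uniform rate, so that
    integrals pass to the limit ([probability_with_moments]). Conversely, any
    measure with the given S-transform has these moments, by uniqueness of power
    series expansions ([is_rho_moments]). Since it has compact support, Bernstein
    approximation together with the moment bounds on the tails gives weak
    convergence ([avg_weak_cvg]). Finally the roots of p_m are symmetric, and
    averaging f over them amounts to averaging (f(sqrt t) + f(- sqrt t)) / 2 over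
    the roots of Q_m. *)

(** * Formal power series and the Riccati form of the hypergeometric recurrence *)

Section big_limits.
Variable R : realType.

Lemma cvg_bigsum (I : Type) (r : seq I) (F : nat -> I -> R) (l : I -> R) :
  (forall t, F m t @[m --> \oo] --> l t) ->
  \sum_(t <- r) F m t @[m --> \oo] --> \sum_(t <- r) l t.
Proof.
move=> Fl; elim: r => [|t r IH].
  by rewrite big_nil; under eq_fun do rewrite big_nil; exact: cvg_cst.
by rewrite big_cons; under eq_fun do rewrite big_cons; exact: cvgD.
Qed.

Lemma cvg_bigprod (I : Type) (r : seq I) (F : nat -> I -> R) (l : I -> R) :
  (forall t, F m t @[m --> \oo] --> l t) ->
  \prod_(t <- r) F m t @[m --> \oo] --> \prod_(t <- r) l t.
Proof.
move=> Fl; elim: r => [|t r IH].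
  by rewrite big_nil; under eq_fun do rewrite big_nil; exact: cvg_cst.
by rewrite big_cons; under eq_fun do rewrite big_cons; exact: cvgM.
Qed.

End big_limits.

Section formal_series.
Variable R : realType.
Implicit Types (p q w v : {poly R}) (c : R).

(** Congruence of polynomials modulo X^(n+1). Power series are handled through
    their truncations, and [eqXn] is the equality of two truncations. *)
Definition eqXn (n : nat) p q := forall k, (k <= n)%N -> p`_k = q`_k.

Lemma eqXn_refl n p : eqXn n p p.
Proof. by []. Qed.

Lemma eqXn_sym n p q : eqXn n p q -> eqXn n q p.
Proof. by move=> pq k kn; rewrite pq. Qed.

Lemma eqXn_trans n p q v : eqXn n p q -> eqXn n q v -> eqXn n p v.
Proof. by move=> pq qv k kn; rewrite pq// qv. Qed.

Lemma eqXnD n p q p' q' : eqXn n p p' -> eqXn n q q' -> eqXn n (p + q) (p' + q').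
Proof. by move=> pp qq k kn; rewrite !coefD pp// qq. Qed.

Lemma eqXnN n p q : eqXn n p q -> eqXn n (- p) (- q).
Proof. by move=> pp k kn; rewrite !coefN pp. Qed.

Lemma eqXnZ n c p q : eqXn n p q -> eqXn n (c *: p) (c *: q).
Proof. by move=> pp k kn; rewrite !coefZ pp. Qed.

Lemma eqXnM n p q p' q' : eqXn n p p' -> eqXn n q q' -> eqXn n (p * q) (p' * q').
Proof.
move=> pp qq k kn; rewrite !coefM; apply: eq_bigr => l _.
by rewrite pp ?qq// (leq_trans _ kn)// ?leq_subr// -ltnS.
Qed.

(** A polynomial with constant coefficient 1 is invertible modulo X^(n+1). *)
Lemma eqXn_cancel n p q v : v`_0 = 1 ->
  eqXn n (p * v) (q * v) -> eqXn n p q.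
Proof.
move=> v0 pq k; elim/ltn_ind: k => k IH kn.
have := pq k kn; rewrite !coefM !big_ord_recr/= subnn v0 !mulr1.
suff -> : \sum_(l < k) p`_l * v`_(k - l) = \sum_(l < k) q`_l * v`_(k - l).
  exact: addrI.
by apply: eq_bigr => l _; rewrite IH// (leq_trans _ kn)// ltnW.
Qed.

(** The rescaled Euler operator c X d/dX. *)
Definition euler c p : {poly R} := c *: ('X * p^`()).

Lemma coef_euler c p k : (euler c p)`_k = c * k%:R * p`_k.
Proof.
rewrite coefZ coefXM; case: k => [|k] /=; first by rewrite !(mulr0, mul0r).
by rewrite coef_deriv -[p`_k.+1 *+ _]mulr_natl mulrA.
Qed.

Lemma eulerM c p q : euler c (p * q) = euler c p * q + p * euler c q.
Proof.
rewrite /euler derivM -!mul_polyC. ring.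
Qed.

Lemma eqXn_euler n c p q : eqXn n p q -> eqXn n (euler c p) (euler c q).
Proof. by move=> pq k kn; rewrite !coef_euler pq. Qed.

(** The operator prod_t (a_t - D) applied to [p], with D = [euler c]. *)
Definition diff_ops (I : Type) c (a : I -> R) (r : seq I) p :=
  foldr (fun t q => a t *: q - euler c q) p r.

(** The operator prod_t (a_t - (D + w)) applied to [p], where w acts by
    multiplication. *)
Definition twisted_ops (I : Type) c w (a : I -> R) (r : seq I) p :=
  foldr (fun t q => a t *: q - (euler c q + w * q)) p r.

Lemma coef_diff_ops (I : Type) c (a : I -> R) (r : seq I) p k :
  (diff_ops c a r p)`_k = (\prod_(t <- r) (a t - c * k%:R)) * p`_k.
Proof.
elim: r => [|t r IH] /=; first by rewrite big_nil mul1r.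
by rewrite big_cons coefB coefZ coef_euler IH; ring.
Qed.

(** If D p = w p, multiplication by [p] intertwines D + w and D. *)
Lemma diff_ops_twisted (I : Type) n c w (a : I -> R) (r : seq I) p v :
  eqXn n (euler c p) (w * p) ->
  eqXn n (diff_ops c a r (v * p)) (twisted_ops c w a r v * p).
Proof.
move=> Dp; elim: r => [//|t r IH] /=.
set q := diff_ops _ _ _ _ in IH *; set u := twisted_ops _ _ _ _ _ in IH *.
rewrite mulrBl -scalerAl; apply: eqXnD; first exact: eqXnZ.
apply: eqXnN; apply: (eqXn_trans (eqXn_euler _ IH)).
rewrite eulerM mulrDl; apply: eqXnD => //.
rewrite (_ : w * u * p = u * (w * p)); last by ring.
exact: eqXnM.
Qed.

(** The hypergeometric recurrence for the coefficients of [p], rewritten as an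
    equation for its logarithmic derivative [w]. *)
Lemma hypergeometric_riccati (I J : Type) n c w (a : I -> R) (r : seq I)
    (b : J -> R) (s : seq J) p : p`_0 = 1 ->
  eqXn n (euler c p) (w * p) ->
  (forall k, c * k.+1%:R * (\prod_(t <- r) (a t - c * k%:R)) * p`_k.+1 =
     - ((1 - c * k%:R) * (\prod_(t <- s) (b t - c * k%:R)) * p`_k)) ->
  eqXn n (twisted_ops c w (fun t => a t + c) r w)
         (- 'X * twisted_ops c w b s (1 - w)).
Proof.
move=> p0 Dp rec; apply: (eqXn_cancel p0).
apply: (eqXn_trans (eqXn_sym (diff_ops_twisted _ _ _ Dp))).
have Hb : eqXn n (diff_ops c b s (p - euler c p)) (twisted_ops c w b s (1 - w) * p).
  apply: eqXn_trans (diff_ops_twisted _ _ _ Dp) => k kn.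
  by rewrite !coef_diff_ops mulrBl mul1r !coefB Dp.
have Ha : eqXn n (diff_ops c (fun t => a t + c) r (w * p))
                 (diff_ops c (fun t => a t + c) r (euler c p)).
  by move=> k kn; rewrite !coef_diff_ops Dp.
apply: (eqXn_trans Ha); rewrite -mulrA.
apply: eqXn_trans (eqXnM (@eqXn_refl _ _) Hb) => k kn.
rewrite mulNr coefN coefXM !coef_diff_ops; case: k kn => [|k] kn /=.
  by rewrite coef_euler !(mulr0, mul0r) oppr0.
rewrite coefB !coef_euler.
transitivity (c * k.+1%:R * (\prod_(t <- r) (a t - c * k%:R)) * p`_k.+1).
  rewrite [LHS]mulrC mulrAC; congr (_ * _ * _).
  by apply: eq_bigr => t _; rewrite -natr1; ring.
by rewrite rec; ring.
Qed.

Lemma coefM0 p q : (p * q)`_0 = p`_0 * q`_0.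
Proof. by rewrite coefM big_ord_recl big_ord0 addr0 subnn. Qed.

Lemma twisted_ops_eqXn (I : Type) n c w w' (a : I -> R) (r : seq I) v v' :
  eqXn n w w' -> eqXn n v v' ->
  eqXn n (twisted_ops c w a r v) (twisted_ops c w' a r v').
Proof.
move=> ww vv; elim: r => [//|t r IH] /=.
apply: eqXnD; first exact: eqXnZ.
by apply: eqXnN; apply: eqXnD; [exact: eqXn_euler|exact: eqXnM].
Qed.

(** The coefficient of X^(n+1) in [twisted_ops] is affine in the coefficient of
    X^(n+1) of the data, with an explicit slope. *)
Lemma twisted_ops_top (I : Type) n c w w' (a : I -> R) (r : seq I) v v' :
  w`_0 = 0 -> v`_0 = 0 -> eqXn n w w' -> eqXn n v v' ->
  (twisted_ops c w a r v)`_n.+1 - (twisted_ops c w' a r v')`_n.+1 =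
  (\prod_(t <- r) (a t - c * n.+1%:R)) * (v`_n.+1 - v'`_n.+1).
Proof.
move=> w0 v0 ww vv; elim: r => [|t r IH] /=; first by rewrite big_nil mul1r.
have qq := @twisted_ops_eqXn _ n c w w' a r v v' ww vv.
have q0 : (twisted_ops c w a r v)`_0 = 0.
  elim: r {IH qq} => [//|s r IH] /=.
  by rewrite coefB coefD coef_euler coefZ coefM0 IH !(mulr0, mul0r) addr0 subr0.
set q := twisted_ops c w a r v in IH qq q0 *.
set q' := twisted_ops c w' a r v' in IH qq *.
rewrite !coefB !coefD !coef_euler !coefZ.
have -> : (w * q)`_n.+1 = (w' * q')`_n.+1.
  have q'0 : q'`_0 = 0 by rewrite -qq.
  have w'0 : w'`_0 = 0 by rewrite -ww.
  rewrite !coefM big_ord_recl big_ord_recr/= [RHS]big_ord_recl [in RHS]big_ord_recr/=.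
  rewrite /bump/= !add1n !subnn q0 q'0 w0 w'0 !(mulr0, mul0r, addr0, add0r).
  apply: eq_bigr => l _; rewrite /bump/= !add1n ww//; congr (_ * _).
  by rewrite qq// subSS leq_subr.
by rewrite big_cons -[RHS]mulrA -IH; ring.
Qed.

Implicit Types u : nat -> {poly R}.

(** Coefficientwise convergence of polynomials up to degree [n]. *)
Definition cvgXn n (u : nat -> {poly R}) (l : {poly R}) :=
  forall k, (k <= n)%N -> (u m)`_k @[m --> \oo] --> l`_k.

Lemma cvgXnD n u l (v : nat -> {poly R}) k : cvgXn n u l -> cvgXn n v k ->
  cvgXn n (fun m => u m + v m) (l + k).
Proof.
move=> ul vk t tn; rewrite coefD; under eq_fun do rewrite coefD.
by apply: cvgD; [exact: ul|exact: vk].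
Qed.

Lemma cvgXnB n u l (v : nat -> {poly R}) k : cvgXn n u l -> cvgXn n v k ->
  cvgXn n (fun m => u m - v m) (l - k).
Proof.
move=> ul vk t tn; rewrite coefB; under eq_fun do rewrite coefB.
by apply: cvgB; [exact: ul|exact: vk].
Qed.

Lemma cvgXnM n u l (v : nat -> {poly R}) k : cvgXn n u l -> cvgXn n v k ->
  cvgXn n (fun m => u m * v m) (l * k).
Proof.
move=> ul vk t tn; rewrite coefM; under eq_fun do rewrite coefM.
apply: cvg_bigsum => s; apply: cvgM.
  by apply: ul; rewrite (leq_trans _ tn)// -ltnS.
by apply: vk; rewrite (leq_trans _ tn)// leq_subr.
Qed.

Lemma cvgXnZ n u l (a : nat -> R) a0 : cvgXn n u l -> a m @[m --> \oo] --> (a0 : R) ->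
  cvgXn n (fun m => a m *: u m) (a0 *: l).
Proof.
move=> ul vk t tn; rewrite coefZ; under eq_fun do rewrite coefZ.
by apply: cvgM => //; exact: ul.
Qed.

Lemma cvgXn_euler n u l (c : nat -> R) : cvgXn n u l -> c m @[m --> \oo] --> (0 : R) ->
  cvgXn n (fun m => euler (c m) (u m)) 0.
Proof.
move=> ul c0 t tn; rewrite coef0; under eq_fun do rewrite coef_euler.
suff: c m * t%:R * (u m)`_t @[m --> \oo] --> 0 * t%:R * l`_t by rewrite !mul0r.
by apply: cvgM; [apply: cvgM => //; exact: cvg_cst|exact: ul].
Qed.

(** When c tends to 0 the Euler operator disappears in the limit of
    [twisted_ops]. *)
Lemma cvgXn_twisted (I : Type) n (c : nat -> R) (w : nat -> {poly R}) w0
  (a : nat -> I -> R) A (r : seq I) (v : nat -> {poly R}) v0 :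
  c m @[m --> \oo] --> (0 : R) -> (forall t, a m t @[m --> \oo] --> (A t : R)) ->
  cvgXn n w w0 -> cvgXn n v v0 ->
  cvgXn n (fun m => twisted_ops (c m) (w m) (a m) r (v m))
          ((\prod_(t <- r) ((A t)%:P - w0)) * v0).
Proof.
move=> c0 aA ww vv; elim: r => [|t r IH] /=; first by rewrite big_nil mul1r.
rewrite big_cons; set q := \prod_(_ <- r) _ in IH *.
have -> : ((A t)%:P - w0) * q * v0 = A t *: (q * v0) - (0 + w0 * (q * v0)).
  by rewrite -mul_polyC; ring.
apply: cvgXnB; first exact: cvgXnZ.
by apply: cvgXnD; [exact: cvgXn_euler IH c0|exact: cvgXnM].
Qed.

End formal_series.
Arguments cvgXn_twisted {R I n c w w0 a A} r {v v0}.

Section formal_limit.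
Variable R : realType.

(** The truncation at order [n] of the series with coefficients [c], whose
    constant term is taken to be 0 whatever [c 0] is. *)
Definition gseries (c : nat -> R) n : {poly R} :=
  \poly_(k < n.+1) (if k is 0 then 0 else c k).

Lemma gseries0 c n : (gseries c n)`_0 = 0.
Proof. by rewrite coef_poly. Qed.

Lemma coef_gseries c n k : (0 < k <= n)%N -> (gseries c n)`_k = c k.
Proof. by case: k => // k /=; rewrite coef_poly ltnS => ->. Qed.

(** The moments [mom m] satisfy, for each m > 0, the Riccati-type equation with
    parameters [a m] and [b m] and with c = 1/m. *)
Variables (I J : finType) (A : I -> R) (B : J -> R).
Variables (a : nat -> I -> R) (b : nat -> J -> R) (mom : nat -> nat -> R).
Hypothesis A0 : forall t, A t != 0.
Hypothesis aA : forall t, a m t @[m --> \oo] --> A t.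
Hypothesis bB : forall t, b m t @[m --> \oo] --> B t.
Let c m : R := m%:R^-1.
Hypothesis riccati : forall m n, (0 < m)%N ->
  eqXn n (twisted_ops (c m) (- gseries (mom m) n) (fun t => a m t + c m)
            (index_enum I) (- gseries (mom m) n))
         (- 'X * twisted_ops (c m) (- gseries (mom m) n) (b m)
            (index_enum J) (1 + gseries (mom m) n)).

Let c0 : c m @[m --> \oo] --> 0.
Proof.
rewrite -(cvg_shiftS c); exact: cvg_harmonic.
Qed.

Let acA t : a m t + c m @[m --> \oo] --> A t.
Proof. by rewrite -[A t]addr0; apply: cvgD. Qed.

(** The truncation of the series at order n determines all the terms of the
    coefficient of X^(n+1) except the one containing the moment of order n+1. *)
Lemma moments_cvg_exist n : (0 < n)%N -> exists l : R, mom m n @[m --> \oo] --> l.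
Proof.
elim/ltn_ind: n => -[//|n] IH _.
have [d dP] : exists d : nat -> R, forall k, (0 < k <= n)%N ->
    mom m k @[m --> \oo] --> d k.
  have H k : exists l : R, (0 < k <= n)%N -> mom m k @[m --> \oo] --> l.
    case: (boolP (0 < k <= n)%N) => [/andP[k0 kn]|_]; last by exists 0.
    by have [l lP] := IH k kn k0; exists l.
  by have [d dP] := choice H; exists d.
pose w m := - gseries (mom m) n.+1; pose w' m := - gseries (mom m) n.
have ww' m : eqXn n (w m) (w' m).
  move=> k kn; rewrite !coefN; congr (- _).
  by rewrite !coef_poly !ltnS kn (leqW kn).
have cvw : cvgXn n.+1 w' (- gseries d n).
  move=> k kn; rewrite coefN; under eq_fun do rewrite coefN.
  apply: cvgN; case: k kn => [|k] kn.
    by rewrite gseries0; under eq_fun do rewrite gseries0; exact: cvg_cst.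
  rewrite coef_poly; under eq_fun do rewrite coef_poly.
  by case: ifP => // kk; [exact: dP|exact: cvg_cst].
have cva := cvgXn_twisted (index_enum I) c0 acA cvw cvw.
have cv1w : cvgXn n.+1 (fun m => 1 - w' m) (1 - (- gseries d n)).
  by apply: cvgXnB => // k _; exact: cvg_cst.
have cvb := cvgXn_twisted (index_enum J) c0 bB cvw cv1w.
have kap : \prod_(t <- index_enum I) (a m t + c m - c m * n.+1%:R)
    @[m --> \oo] --> \prod_(t <- index_enum I) A t.
  apply: cvg_bigprod => t.
  rewrite -[A t]subr0; apply: cvgB => //.
  suff: c m * n.+1%:R @[m --> \oo] --> (0 * n.+1%:R : R) by rewrite mul0r.
  by apply: cvgM => //; exact: cvg_cst.
have kap0 : \prod_(t <- index_enum I) A t != 0.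
  by apply/prodf_neq0 => t _; exact: A0.
eexists; apply: cvg_trans; last first.
  apply: (cvgM (cvgD (cvb n (leqnSn n)) (cva n.+1 (leqnn _))) (cvgV kap0 kap)).
apply: near_eq_cvg; near=> m.
have m0 : (0 < m)%N by near: m; exact: nbhs_infty_gt.
(* [w] and [w'] differ only in degree n+1, by the moment of that order; the
   factor X on the other side lowers the degree, so only [w'] matters there. *)
have := @riccati m n.+1 m0 n.+1 (leqnn _).
rewrite mulNr coefN coefXM/= -/(w m) => E1.
have E2 := @twisted_ops_top _ _ n (c m) (w m) (w' m) (fun t => a m t + c m)
    (index_enum I) (w m) (w' m).
have w0 : (w m)`_0 = 0 by rewrite coefN gseries0 oppr0.
move: (E2 w0 w0 (ww' m) (ww' m)); rewrite E1.
have -> : (w m)`_n.+1 = - mom m n.+1 by rewrite coefN coef_gseries ?leqnn.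
have -> : (w' m)`_n.+1 = 0 by rewrite coefN coef_poly ltnn oppr0.
have -> : 1 + gseries (mom m) n.+1 = 1 - w m by rewrite opprK.
have -> : (twisted_ops (c m) (w m) (b m) (index_enum J) (1 - w m))`_n =
    (twisted_ops (c m) (w' m) (b m) (index_enum J) (1 - w' m))`_n.
  by apply: (@twisted_ops_eqXn _ _ n) => //; apply: eqXnD => //; apply: eqXnN.
set K := \prod_(t <- _) _; have K0 : K != 0.
  by rewrite /K; near: m; exact: cvgr_neq0 kap kap0.
move=> E3; apply: (mulIf K0); rewrite /= divfK//.
by rewrite -[LHS]opprK opprD E3 subr0 mulrN opprK mulrC.
Unshelve. all: by end_near. Qed.

Lemma moments_cvg : exists d : nat -> R,
  (forall n, (0 < n)%N -> mom m n @[m --> \oo] --> d n) /\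
  (forall n, let T := gseries d n in
    eqXn n (T * \prod_t ((A t)%:P + T)) ('X * (1 + T) * \prod_t ((B t)%:P + T))).
Proof.
have [d dP] : exists d : nat -> R, forall n, (0 < n)%N ->
    mom m n @[m --> \oo] --> d n.
  have H k : exists l : R, (0 < k)%N -> mom m k @[m --> \oo] --> l.
    case: (posnP k) => [->|k0]; first by exists 0.
    by have [l lP] := moments_cvg_exist k0; exists l.
  by have [d dP] := choice H; exists d.
exists d; split=> // n T k kn.
pose w m := - gseries (mom m) n.
have cvw : cvgXn n w (- T).
  move=> l ln; rewrite coefN; under eq_fun do rewrite coefN.
  apply: cvgN; case: l ln => [|l] ln.
    by rewrite gseries0; under eq_fun do rewrite gseries0; exact: cvg_cst.
  rewrite coef_gseries//; under eq_fun do rewrite coef_gseries//.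
  exact: dP.
have cva := cvgXn_twisted (index_enum I) c0 acA cvw cvw.
have cv1w : cvgXn n (fun m => 1 - w m) (1 - (- T)).
  by apply: cvgXnB => // l _; exact: cvg_cst.
have cvb := cvgXn_twisted (index_enum J) c0 bB cvw cv1w.
have cvX : cvgXn n (fun=> - 'X) (- 'X : {poly R}) by move=> l _; exact: cvg_cst.
have cvXb := cvgXnM cvX cvb.
have H1 := cva k kn; have H2 := cvXb k kn.
have H3 : (twisted_ops (c m) (w m) (fun t => a m t + c m) (index_enum I) (w m))`_k
    @[m --> \oo] --> (- 'X * (\prod_t ((B t)%:P - - T) * (1 - - T)))`_k.
  apply: cvg_trans H2; apply: near_eq_cvg; near=> m.
  have m0 : (0 < m)%N by near: m; exact: nbhs_infty_gt.
  by rewrite (@riccati m n m0 k kn) /w opprK.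
have := cvg_unique (@Rhausdorff R) H1 H3.
rewrite mulrN mulNr !coefN => /(_ _)/eqP; rewrite eqr_opp => /eqP.
rewrite !opprK (mulrC _ T) => ->.
by rewrite mulrA mulrAC.
Unshelve. all: by end_near. Qed.

End formal_limit.

(** * Power sums of the roots of an even hypergeometric polynomial *)

Section log_derivative.
Variable R : realType.
Implicit Types (s : seq R) (P : {poly R}).

Lemma gseries_geometric (x : R) n :
  eqXn n (gseries (fun k => x ^+ k) n * (1 - x *: 'X)) (x *: 'X).
Proof.
move=> k kn; rewrite mulrBr mulr1 -scalerAr coefB !coefZ coefMX coefX.
case: k kn => [|[|k]] kn /=; first by rewrite gseries0; ring.
  by rewrite gseries0 coef_gseries// expr1; ring.
by rewrite !coef_gseries ?(ltnW kn)// exprS; ring.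
Qed.

Lemma gseriesD (c d : nat -> R) n :
  gseries (fun k => c k + d k) n = gseries c n + gseries d n.
Proof.
apply/polyP => k; rewrite coefD !coef_poly.
by case: ifP => _; [case: k => *; rewrite ?addr0|rewrite addr0].
Qed.

(** Newton's identities: the logarithmic derivative of prod_x (1 - x X) is the
    generating series of the power sums, up to sign. *)
Lemma log_derivative_power_sums s n :
  let G := \prod_(x <- s) (1 - x *: 'X) in
  eqXn n ('X * G^`()) (- gseries (fun k => \sum_(x <- s) x ^+ k) n * G).
Proof.
elim: s => [|x s IH] /=.
  move=> k kn; rewrite !big_nil derivC mulr0 mulr1 coefN coef0 coef_poly.
  by case: ifP => _; [case: k {kn} => *; rewrite ?big_nil oppr0|rewrite oppr0].
set G := \prod_(_ <- s) _ in IH; rewrite /= in IH.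
set S := gseries _ n in IH.
have -> : gseries (fun k => \sum_(y <- x :: s) y ^+ k) n =
    gseries (fun k => x ^+ k) n + S.
  rewrite -gseriesD; congr gseries; apply/funext => k; exact: big_cons.
rewrite big_cons -/G; set g := gseries _ n.
have -> : 'X * ((1 - x *: 'X) * G)^`() =
    - (x *: 'X) * G + (1 - x *: 'X) * ('X * G^`()).
  rewrite derivM derivB derivC derivZ derivX -!mul_polyC; ring.
have -> : - (g + S) * ((1 - x *: 'X) * G) =
    - (g * (1 - x *: 'X)) * G + (1 - x *: 'X) * (- S * G) by ring.
apply: eqXnD; last exact: eqXnM.
by apply: eqXnM => //; apply: eqXnN; apply/eqXn_sym/gseries_geometric.
Qed.

Lemma poly_eq_on_nat_inverse (p q : {poly R}) :
  (forall k, p.[(k.+1%:R ^+ 2)^-1] = q.[(k.+1%:R ^+ 2)^-1]) -> p = q.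
Proof.
move=> pq; apply/eqP; rewrite -subr_eq0; apply/negP => /negP d0.
(* more roots of [p - q] than its degree allows *)
pose r := [seq ((k.+1%:R : R) ^+ 2)^-1 | k <- iota 0 (size (p - q))].
have := @max_poly_roots _ (p - q) r d0.
rewrite size_map size_iota ltnn => H; suff: false by [].
apply: H; last first.
  rewrite map_inj_uniq ?iota_uniq// => k l /invr_inj/eqP.
  by rewrite eqrXn2 ?ler0n// eqr_nat eqSS => /eqP.
apply/allP => _ /mapP[k _ ->].
by rewrite rootE !hornerE pq subrr.
Qed.

End log_derivative.

Section hypergeometric_polynomial.
Variable R : realType.
Variables (m : nat) (i j : nat) (a : 'I_i -> R) (b : 'I_j -> R).
Hypothesis m0 : (0 < m)%N.
Let M : R := m%:R.
Let M0 : M != 0. Proof. by rewrite pnatr_eq0 -lt0n. Qed.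

Lemma fallingS (x : R) k : falling x k.+1 = falling x k * (x - k%:R).
Proof. by rewrite /falling big_ord_recr. Qed.

Lemma falling_neq0 (x : R) k :
  (forall l, (l < k)%N -> x <> l%:R) -> falling x k != 0.
Proof.
move=> xl; apply/prodf_neq0 => l _; rewrite subr_eq0; apply/eqP/xl.
exact: ltn_ord.
Qed.

Lemma hyp_coef_rec k : admissible m a -> (k < m)%N ->
  hyp_coef m b a k.+1 * k.+1%:R * \prod_(t < i) (M * a t - k%:R) =
  hyp_coef m b a k * (M - k%:R) * \prod_(t < j) (M * b t - k%:R).
Proof.
move=> adm km; rewrite /hyp_coef.
have -> : \prod_(t < j) falling (m%:R * b t) k.+1 =
    \prod_(t < j) falling (m%:R * b t) k * \prod_(t < j) (M * b t - k%:R).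
  by rewrite -big_split; apply: eq_bigr => t _; rewrite fallingS.
have -> : \prod_(t < i) falling (m%:R * a t) k.+1 =
    \prod_(t < i) falling (m%:R * a t) k * \prod_(t < i) (M * a t - k%:R).
  by rewrite -big_split; apply: eq_bigr => t _; rewrite fallingS.
have aM t l : (l < m)%N -> m%:R * a t <> l%:R.
  by move=> lm e; apply: (adm t l lm); rewrite -e mulrAC divff// mul1r.
have f0 : \prod_(t < i) falling (m%:R * a t) k != 0.
  apply/prodf_neq0 => t _; apply: falling_neq0 => l lk.
  by apply: aM; exact: ltn_trans km.
have p0 : \prod_(t < i) (M * a t - k%:R) != 0.
  by apply/prodf_neq0 => t _; rewrite subr_eq0; apply/eqP/aM.
have binE : 'C(m, k.+1)%:R * k.+1%:R = 'C(m, k)%:R * (M - k%:R) :> R.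
  by rewrite -natrB ?(ltnW km)// -!natrM mulnC mul_bin_left mulnC.
rewrite invfM.
set X := \prod_(t < i) (M * a t - k%:R) in p0 *.
set Y := \prod_(t < i) falling _ _ in f0 *.
set Z := \prod_(t < j) falling _ _; set W := \prod_(t < j) _.
transitivity ('C(m, k.+1)%:R * k.+1%:R * (Z * W / Y)); last by rewrite binE; ring.
by field; rewrite p0 f0.
Qed.

(** The polynomial sum_k (-1)^k gam^k e_k X^k, the reversal of the
    hypergeometric polynomial dilated by gam. *)
Definition rev_hyp (gam : R) : {poly R} :=
  \poly_(k < m.+1) ((-1) ^+ k * gam ^+ k * hyp_coef m b a k).

Lemma rev_hyp0 gam : (rev_hyp gam)`_0 = 1.
Proof. by rewrite coef_poly/= !expr0 hyp_coef0 !mulr1. Qed.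

Lemma rev_hyp_rec gam k : admissible m a -> gam * M ^+ j = M ^+ i ->
  M^-1 * k.+1%:R * (\prod_(t < i) (a t - M^-1 * k%:R)) * (rev_hyp gam)`_k.+1 =
  - ((1 - M^-1 * k%:R) * (\prod_(t < j) (b t - M^-1 * k%:R)) * (rev_hyp gam)`_k).
Proof.
move=> adm gamE; rewrite !coef_poly ltnS.
have [mk|km|mk] := ltngtP m k.
- by rewrite /= ltnS leqNgt mk !mulr0 oppr0.
- rewrite ltnS (ltnW km).
  have prodE n (c : 'I_n -> R) : \prod_(t < n) (M * c t - k%:R) =
      M ^+ n * \prod_(t < n) (c t - M^-1 * k%:R).
    have -> : M ^+ n = \prod_(t < n) M by rewrite prodr_const card_ord.
    by rewrite -big_split/=; apply: eq_bigr => t _; field.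
  have := hyp_coef_rec adm km; rewrite !prodE => H.
  set h1 := hyp_coef _ _ _ _ in H *; set h := hyp_coef _ _ _ _ in H *.
  set pa := \prod_(t < i) _ in H *; set pb := \prod_(t < j) _ in H *.
  have Mj : M * M ^+ j != 0 by rewrite mulf_neq0// expf_neq0.
  apply: (mulIf Mj); rewrite !exprS.
  transitivity (- ((-1) ^+ k * gam ^+ k) * (h1 * k.+1%:R * (M ^+ i * pa))).
    by rewrite -gamE; field.
  by rewrite H; field.
- by rewrite /= -mk -/M mulVf// subrr !(mul0r, mulr0) oppr0.
Qed.

Lemma size_hyp_even_poly : (size (hyp_even_poly m b a)).-1 = m.*2.
Proof.
by rewrite size_comp_poly size_hyp_poly size_polyXn /= muln2.
Qed.

(** Up to a power of s, the dilated even polynomial at s is the reversed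
    polynomial at 1 / s^2. *)
Lemma dil_hyp_horner (alpha s : R) : alpha != 0 -> s != 0 ->
  (dil alpha%:C (hyp_even_poly m b a)).[s%:C] =
  (s ^+ m.*2 * (rev_hyp (alpha ^+ 2)).[(s ^+ 2)^-1])%:C.
Proof.
move=> al0 s0; rewrite /dil size_hyp_even_poly hornerZ /hyp_even_poly.
rewrite !horner_comp hornerXn hornerZ hornerX !horner_poly.
rewrite -fmorphV -rmorphM -!rmorphXn/=.
rewrite mulr_sumr (reindex_inj rev_ord_inj)/= mulr_sumr rmorph_sum.
apply: eq_bigr => k _ /=; rewrite subSS.
have km : (k <= m)%N by rewrite -ltnS.
rewrite subKn// -rmorphXn -[(-1) ^+ k](rmorph_sign (real_complex R)) -!rmorphM.
congr (_%:C).
have mE : m.*2 = (2 * (m - k) + 2 * k)%N by rewrite -mulnDr subnK// mul2n.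
have sq2 (x : R) n : x ^+ (2 * n) = x ^+ n * x ^+ n by rewrite mul2n -addnn exprD.
have sq1 (x : R) n : (x ^+ 2) ^+ n = x ^+ n * x ^+ n by rewrite -exprM sq2.
rewrite mE (exprD alpha) (exprD s) !sq2 exprVn !sq1 exprMn exprVn.
have u0 : alpha ^+ (m - k) != 0 by rewrite expf_neq0.
have v0 : s ^+ k != 0 by rewrite expf_neq0.
by field; rewrite u0 v0.
Qed.

Variables (alpha : R) (xs : seq R) (p : {poly R[i]}).
Hypothesis al0 : alpha != 0.
Hypothesis pE : p = dil alpha%:C (hyp_even_poly m b a).
Hypothesis pxs : p = \prod_(x <- xs) ('X - (x%:C)%:P).
Hypothesis sxs : size xs = m.*2.
Hypothesis peven : p \Po (- 'X) = p.

(** Each root y of Q_m is counted twice in the list of squares of the roots of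
    p_m, whence the square of the reversed polynomial. *)
Lemma rev_hyp_square :
  \prod_(x <- [seq x ^+ 2 | x <- xs]) (1 - x *: 'X) =
  rev_hyp (alpha ^+ 2) * rev_hyp (alpha ^+ 2).
Proof.
apply: poly_eq_on_nat_inverse => k; set s : R := k.+1%:R.
have s0 : s != 0 by rewrite pnatr_eq0.
rewrite hornerM horner_prod big_map.
have ps (u : R) : p.[u%:C] = (\prod_(x <- xs) (u - x))%:C.
  rewrite pxs horner_prod rmorph_prod; apply: eq_bigr => x _.
  by rewrite !hornerE rmorphB.
have psN : p.[(- s)%:C] = p.[s%:C].
  by rewrite -[in RHS]peven horner_comp !hornerE rmorphN.
have E1 := dil_hyp_horner al0 s0; rewrite -pE in E1.
set P := (rev_hyp _).[_] in E1 *.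
have : p.[s%:C] * p.[(- s)%:C] = p.[s%:C] * p.[s%:C] by rewrite psN.
rewrite [in RHS]E1 !ps -!rmorphM => /complexI; rewrite -big_split/= => E2.
have s4 : s ^+ m.*2 * s ^+ m.*2 != 0 by rewrite mulf_neq0// expf_neq0.
apply: (mulfI s4); rewrite mulrACA -E2.
have -> : s ^+ m.*2 * s ^+ m.*2 = \prod_(x <- xs) - (s ^+ 2).
  rewrite big_const_seq count_predT sxs iter_mulr_1 -!mul2n !exprM sqrrN.
  by rewrite -exprMn -expr2.
rewrite -big_split/=; apply: eq_bigr => x _; rewrite !hornerE.
by field.
Qed.

Lemma rev_hyp_euler n :
  eqXn n (euler M^-1 (rev_hyp (alpha ^+ 2)))
    (- gseries (fun k => (m.*2)%:R^-1 * \sum_(x <- xs) (x ^+ 2) ^+ k) n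
       * rev_hyp (alpha ^+ 2)).
Proof.
set P := rev_hyp _.
have := @log_derivative_power_sums R [seq x ^+ 2 | x <- xs] n.
rewrite /= rev_hyp_square -/P derivM => H.
set g := gseries _ n.
have gE : gseries (fun k => \sum_(x <- [seq x ^+ 2 | x <- xs]) x ^+ k) n =
    (M *+ 2) *: g.
  apply/polyP => k; rewrite coefZ !coef_poly; case: ifP => _; last by rewrite mulr0.
  case: k => [|k]; first by rewrite mulr0.
  rewrite big_map -mul2n natrM -/M -mulr_natl; field.
  by rewrite M0.
rewrite gE in H.
have P0 : P`_0 = 1 by rewrite rev_hyp0.
apply: (eqXn_cancel P0).
have -> : euler M^-1 P * P = (M *+ 2)^-1 *: ('X * (P^`() * P + P * P^`())).
  rewrite /euler -!mul_polyC -mulr_natl invfM polyCM.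
  have : (2^-1 : R)%:P * 2 = 1 by rewrite -polyC_natr -polyCM mulVf.
  move=> h; transitivity ((2^-1)%:P * 2 * (M^-1%:P * ('X * P^`()) * P)); last by ring.
  by rewrite h mul1r.
have -> : - g * P * P = (M *+ 2)^-1 *: (- (M *+ 2 *: g) * (P * P)).
  rewrite -scaleNr -scalerAl scalerA mulrN mulVf ?scaleN1r ?mulNr ?mulrA//.
  by rewrite mulrn_eq0.
exact: eqXnZ.
Qed.

Hypothesis adm : admissible m a.
Hypothesis alE : alpha ^+ 2 * M ^+ j = M ^+ i.

Lemma hyp_moments_equation n :
  let mom k := (m.*2)%:R^-1 * \sum_(x <- xs) (x ^+ 2) ^+ k in
  eqXn n (twisted_ops M^-1 (- gseries mom n) (fun t => a t + M^-1)
            (index_enum 'I_i) (- gseries mom n))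
         (- 'X * twisted_ops M^-1 (- gseries mom n) b
            (index_enum 'I_j) (1 + gseries mom n)).
Proof.
move=> mom.
rewrite -[in 1 + _](opprK (gseries mom n)).
apply: (hypergeometric_riccati (rev_hyp0 (alpha ^+ 2))); first exact: rev_hyp_euler.
by move=> k; exact: rev_hyp_rec.
Qed.

End hypergeometric_polynomial.

(** * Majorants and power series with nonnegative coefficients *)

Section majorants.
Variable R : realType.
Implicit Types (p q : {poly R}) (x y : R).

(** Coefficientwise domination: [q] has nonnegative coefficients bounding those
    of [p] in absolute value. *)
Definition majorized p q := forall k, `|p`_k| <= q`_k.

Lemma majorized_coef_ge0 p q k : majorized p q -> 0 <= q`_k.
Proof. by move=> /(_ k); exact: le_trans. Qed.

Lemma majorizedD p q p' q' : majorized p q -> majorized p' q' ->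
  majorized (p + p') (q + q').
Proof.
by move=> pq pq' k; rewrite !coefD (le_trans (ler_normD _ _))// lerD.
Qed.

Lemma majorizedN p q : majorized p q -> majorized (- p) q.
Proof. by move=> pq k; rewrite coefN normrN. Qed.

Lemma majorizedM p q p' q' : majorized p q -> majorized p' q' ->
  majorized (p * p') (q * q').
Proof.
move=> pq pq' k; rewrite !coefM (le_trans (ler_norm_sum _ _ _))//.
by apply: ler_sum => l _; rewrite normrM ler_pM.
Qed.

Lemma majorizedC (c : R) : majorized c%:P `|c|%:P.
Proof. by move=> k; rewrite !coefC; case: ifP; rewrite ?normr0. Qed.

Lemma majorizedX : majorized 'X 'X.
Proof. by move=> k; rewrite coefX ger0_norm. Qed.

Lemma majorized1 : majorized 1 1.
Proof. by move=> k; rewrite coef1 ger0_norm. Qed.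

Lemma majorized_prod (I : Type) (r : seq I) (F G : I -> {poly R}) :
  (forall t, majorized (F t) (G t)) ->
  majorized (\prod_(t <- r) F t) (\prod_(t <- r) G t).
Proof.
move=> FG; elim: r => [|t r IH]; first by rewrite !big_nil; exact: majorized1.
by rewrite !big_cons; exact: majorizedM.
Qed.

Lemma majorized_prod_sub (I : Type) (r : seq I) (A : I -> R) p q :
  majorized p q ->
  majorized (\prod_(t <- r) ((A t)%:P + p) - (\prod_(t <- r) A t)%:P)
    (\prod_(t <- r) (`|A t|%:P + q) - (\prod_(t <- r) `|A t|)%:P).
Proof.
move=> pq; elim: r => [|t r IH].
  by rewrite !big_nil !subrr => k; rewrite coef0 normr0.
rewrite !big_cons !polyCM.
set F := \prod_(_ <- r) _ in IH *; set G := (\prod_(_ <- r) _)%:P in IH *.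
set F' := \prod_(_ <- r) _ in IH *; set G' := (\prod_(_ <- r) _)%:P in IH *.
have -> : ((A t)%:P + p) * F - (A t)%:P * G = ((A t)%:P + p) * (F - G) + p * G.
  by ring.
have -> : (`|A t|%:P + q) * F' - `|A t|%:P * G' =
  (`|A t|%:P + q) * (F' - G') + q * G' by ring.
apply: majorizedD; apply: majorizedM => //.
  by apply: majorizedD => //; exact: majorizedC.
by rewrite /G /G' -normr_prod; exact: majorizedC.
Qed.

Lemma horner_coefs_le p q x : 0 <= x -> (forall k, p`_k <= q`_k) ->
  p.[x] <= q.[x].
Proof.
move=> x0 pq; rewrite (@horner_coef_wide _ (maxn (size p) (size q)) p) ?leq_maxl//.
rewrite (@horner_coef_wide _ (maxn (size p) (size q)) q) ?leq_maxr//.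
by apply: ler_sum => k _; rewrite ler_wpM2r ?exprn_ge0.
Qed.

(** If all coefficients of [p] up to degree n vanish, then p(x) is smaller than
    the bound q(x0) by a factor (|x| / x0)^(n+1). *)
Lemma majorized_horner_high p q n x x0 : majorized p q -> eqXn n p 0 ->
  0 < x0 -> `|x| <= x0 -> `|p.[x]| <= (`|x| / x0) ^+ n.+1 * q.[x0].
Proof.
move=> pq p0 x0_gt0 xx0.
have r0 : 0 <= `|x| / x0 by rewrite divr_ge0// ltW.
have r1 : `|x| / x0 <= 1 by rewrite ler_pdivrMr// mul1r.
rewrite (@horner_coef_wide _ (maxn (size p) (size q)) p) ?leq_maxl//.
rewrite (@horner_coef_wide _ (maxn (size p) (size q)) q) ?leq_maxr//.
rewrite (le_trans (ler_norm_sum _ _ _))// mulr_sumr.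
apply: ler_sum => k _; rewrite normrM normrX.
have [kn|nk] := leqP k n.
  rewrite p0// coef0 normr0 mul0r mulr_ge0 ?exprn_ge0// mulr_ge0//.
    exact: majorized_coef_ge0 pq.
  by rewrite exprn_ge0// ltW.
rewrite mulrCA ler_pM ?exprn_ge0//.
have -> : `|x| ^+ k = (`|x| / x0) ^+ k * x0 ^+ k.
  by rewrite -exprMn divfK// gt_eqF.
by rewrite ler_wpM2r ?exprn_ge0 ?(ltW x0_gt0)// ler_wiXn2l.
Qed.

End majorants.

Section power_series.
Variable R : realType.
Implicit Types (d : nat -> R) (x : R).

(** The sum of the power series with coefficients [d], without constant term. *)
Definition gsum d x : R := limn [series d k.+1 * x ^+ k.+1]_k.

Lemma horner_gseries d n x :
  (gseries d n).[x] = [series d k.+1 * x ^+ k.+1]_k n.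
Proof.
by rewrite horner_poly big_ord_recl/= mul0r add0r seriesEord.
Qed.

Lemma eqXn_gseries d m n : (m <= n)%N -> eqXn m (gseries d n) (gseries d m).
Proof. by move=> mn k km; rewrite !coef_poly !ltnS km (leq_trans km mn). Qed.

Variables (d : nat -> R) (x0 K : R).
Hypothesis d0 : forall k, 0 <= d k.
Hypothesis x0_gt0 : 0 < x0.
Hypothesis dK : forall n, (gseries d n).[x0] <= K.

Lemma majorized_gseriesB m n : (m <= n)%N ->
  majorized (gseries d n - gseries d m) (gseries d n - gseries d m).
Proof.
move=> mn k; rewrite ger0_norm// coefB subr_ge0.
have [km|mk] := leqP k m; first by rewrite (eqXn_gseries d mn km).
rewrite [leLHS]coef_poly ltnS leqNgt mk/= coef_poly.
by case: ifP => // _; case: k {mk} => // k; exact: d0.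
Qed.

Lemma majorized_gseries n : majorized (gseries d n) (gseries d n).
Proof.
move=> k; rewrite ger0_norm// coef_poly; case: ifP => // _.
by case: k => // k; exact: d0.
Qed.

Lemma cvg_gsum x : `|x| <= x0 -> (gseries d n).[x] @[n --> \oo] --> gsum d x.
Proof.
move=> xx0; under eq_fun do rewrite horner_gseries.
suff : cvgn [series d k.+1 * x ^+ k.+1]_k by [].
apply: normed_cvg.
apply: (@series_le_cvg _ _ (fun k => d k.+1 * x0 ^+ k.+1)).
- by move=> n; exact: normr_ge0.
- by move=> n; rewrite mulr_ge0// exprn_ge0// ltW.
- move=> n; rewrite /= normrM normrX (ger0_norm (d0 _)) ler_wpM2l//.
  by rewrite lerXn2r// nnegrE ltW.
apply: nondecreasing_is_cvgn.
  by apply: nondecreasing_series => n _ _; rewrite mulr_ge0// exprn_ge0// ltW.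
by exists K => _ [n _ <-]; rewrite -horner_gseries.
Qed.

(** The tail of the series at x is controlled by its tail at x0. *)
Lemma gsum_tail n x : `|x| <= x0 ->
  `|gsum d x - (gseries d n).[x]| <=
     (`|x| / x0) ^+ n.+1 * (gsum d x0 - (gseries d n).[x0]).
Proof.
move=> xx0.
have x00 : `|x0| <= x0 by rewrite gtr0_norm.
have H1 : `|(gseries d m).[x] - (gseries d n).[x]| @[m --> \oo] -->
    `|gsum d x - (gseries d n).[x]|.
  by apply: cvg_norm; apply: cvgB; [exact: cvg_gsum|exact: cvg_cst].
have H2 : (`|x| / x0) ^+ n.+1 * ((gseries d m).[x0] - (gseries d n).[x0])
    @[m --> \oo] -->
    (`|x| / x0) ^+ n.+1 * (gsum d x0 - (gseries d n).[x0]).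
  apply: cvgM; first exact: cvg_cst.
  by apply: cvgB; [exact: cvg_gsum|exact: cvg_cst].
apply: ler_cvg_to H1 H2 _; near=> m.
rewrite -!hornerN -!hornerD; apply: majorized_horner_high => //.
  by apply: majorized_gseriesB; near: m; exact: nbhs_infty_ge.
move=> k kn; rewrite coefB (eqXn_gseries d _ kn) ?subrr ?coef0//.
by near: m; exact: nbhs_infty_ge.
Unshelve. all: by end_near. Qed.

Lemma gsum0 : gsum d 0 = 0.
Proof.
apply/cvg_lim => //.
rewrite (_ : series _ = fun=> 0); first exact: cvg_cst.
apply/funext => n; rewrite seriesEnat /= big1// => k _.
by rewrite expr0n mulr0.
Qed.

Lemma gsum_continuous x : `|x| < x0 -> {for x, continuous (gsum d)}.
Proof.
move=> xx0; apply/cvgrPdist_le => e e0.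
have x00 : `|x0| <= x0 by rewrite gtr0_norm.
have [n tailn] : exists n, gsum d x0 - (gseries d n).[x0] <= e / 3.
  have /cvgrPdist_le/(_ (e / 3)) := cvg_gsum x00.
  move=> /(_ _)[|n _ /(_ n (leqnn _))]; first by rewrite divr_gt0.
  by move=> /(le_trans (ler_norm _)) ?; exists n.
have tail y : `|y| <= x0 -> `|gsum d y - (gseries d n).[y]| <= e / 3.
  move=> yx0; rewrite (le_trans (gsum_tail n yx0))// (le_trans _ tailn)//.
  rewrite ler_piMl//; last first.
    by rewrite exprn_ile1 ?divr_ge0 ?(ltW x0_gt0)// ler_pdivrMr// mul1r.
  have := gsum_tail n x00.
  have -> : `|x0| / x0 = 1 by rewrite gtr0_norm// divff// gt_eqF.
  by rewrite expr1n mul1r; exact: le_trans.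
have : {for x, continuous (fun y => (gseries d n).[y])} by exact: continuous_horner.
move=> /cvgrPdist_le/(_ (e / 3))/(_ _)[|r /= r0 Hr]; first by rewrite divr_gt0.
near=> y.
have yx0 : `|y| <= x0.
  near: y; have : `|y| @[y --> x] --> `|x| by exact: cvg_norm.
  by move=> /cvgr_le; exact.
have Hy : `|(gseries d n).[x] - (gseries d n).[y]| <= e / 3.
  by apply: Hr; near: y; exists r.
have := tail x (ltW xx0); have := tail y yx0; move: Hy.
rewrite !ler_norml; lra.
Unshelve. all: by end_near. Qed.

End power_series.

(** * Convergence of the algebraic power series *)

(** In this section [d] is a nonnegative solution of the algebraic equation, as a
    formal power series. *)
Section algebraic_series.
Variable R : realType.
Variables (I J : finType) (A : I -> R) (B : J -> R) (d : nat -> R).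
Hypothesis A0 : forall t, A t != 0.
Hypothesis d0 : forall k, 0 <= d k.
Hypothesis dE : forall n, let T := gseries d n in
  eqXn n (T * \prod_t ((A t)%:P + T)) ('X * (1 + T) * \prod_t ((B t)%:P + T)).

Let alpha := \prod_t `|A t|.
Let alpha_gt0 : 0 < alpha.
Proof. by apply: prodr_gt0 => t _; rewrite normr_gt0. Qed.

Let majA n : majorized (\prod_t ((A t)%:P + gseries d n))
  (\prod_t (`|A t|%:P + gseries d n)).
Proof.
apply: majorized_prod => t; apply: majorizedD; first exact: majorizedC.
exact: majorized_gseries.
Qed.

Let majB n : majorized ('X * (1 + gseries d n) * \prod_t ((B t)%:P + gseries d n))
  ('X * (1 + gseries d n) * \prod_t (`|B t|%:P + gseries d n)).
Proof.
apply: majorizedM.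
  apply: majorizedM; first exact: majorizedX.
  by apply: majorizedD; [exact: majorized1|exact: majorized_gseries].
apply: majorized_prod => t; apply: majorizedD; first exact: majorizedC.
exact: majorized_gseries.
Qed.

(** The equation bounds the truncation at order n+1 by a positive expression in
    the truncation at order n; here [T] occurs in the last factor only through
    terms without constant coefficient. *)
Lemma gseries_step_bound n :
  let T := gseries d n in
  forall k, (alpha *: gseries d n.+1)`_k <=
    ('X * (1 + T) * \prod_t (`|B t|%:P + T) +
     T * (\prod_t (`|A t|%:P + T) - alpha%:P))`_k.
Proof.
move=> T k; set T1 := gseries d n.+1.
set PA := \prod_t (`|A t|%:P + T); set PB := \prod_t (`|B t|%:P + T).
pose U := 'X * (1 + T) * \prod_t ((B t)%:P + T)
  - T * (\prod_t ((A t)%:P + T) - (\prod_t A t)%:P).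
have UW : majorized U ('X * (1 + T) * PB + T * (PA - alpha%:P)).
  apply: majorizedD; first exact: majB.
  apply: majorizedN; apply: majorizedM; first exact: majorized_gseries.
  exact/majorized_prod_sub/majorized_gseries.
apply: le_trans (UW k).
have TT1 : eqXn n T1 T by apply: eqXn_gseries.
rewrite coefZ; have [kn|nk] := ltnP n.+1 k.
  by rewrite coef_poly ltnNge kn/= mulr0.
rewrite -[T1`_k]ger0_norm; last first.
  rewrite coef_poly ltnS nk; case: k {nk} => // k; exact: d0.
rewrite /alpha -normr_prod -normrM -coefZ.
suff -> : ((\prod_t A t) *: T1)`_k = U`_k by [].
have := dE nk; rewrite -/T1 => E.
have {E} -> : ((\prod_t A t) *: T1)`_k =
  ('X * (1 + T1) * \prod_t ((B t)%:P + T1)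
   - T1 * (\prod_t ((A t)%:P + T1) - (\prod_t A t)%:P))`_k.
  rewrite coefB -E -coefB; apply: (congr1 (fun p : {poly R} => p`_k)).
  by rewrite -mul_polyC; ring.
have prodT (H : finType) (C : H -> R) :
    eqXn n (\prod_t ((C t)%:P + T1)) (\prod_t ((C t)%:P + T)).
  elim: (index_enum H) => [|t r IH]; first by rewrite !big_nil.
  by rewrite !big_cons; apply: eqXnM => //; apply: eqXnD.
rewrite /U !coefB; congr (_ - _).
  rewrite -!mulrA !coefXM; case: k nk => [//|k] nk /=.
  by apply: (@eqXnM _ n) => //; apply: eqXnD.
set V1 := _ - _; set V := _ - _.
have VV : eqXn n V1 V by apply: eqXnD.
have V10 : V1`_0 = 0.
  rewrite coefB coefC/= -horner_coef0 horner_prod.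
  apply/eqP; rewrite subr_eq0; apply/eqP.
  by apply: eq_bigr => t _; rewrite hornerD hornerC horner_coef0 gseries0 addr0.
have V0 : V`_0 = 0 by rewrite -VV.
case: k nk => [|k] nk; first by rewrite !coefM0 !gseries0 !mul0r.
rewrite !coefM !(big_ord_recr k.+1)/= !subnn V0 V10 !mulr0 !addr0.
rewrite !big_ord_recl/= !gseries0 !mul0r !add0r; apply: eq_bigr => l _.
rewrite /bump/= !add1n subSS.
have ln : (l.+1 <= n)%N by rewrite (leq_trans (ltn_ord l))// -ltnS.
rewrite TT1// VV// (leq_trans (leq_subr _ _))//.
Qed.

(** The truncations are bounded at some x0 > 0: a bound y0 with
    prod |A| + t close to prod |A| is preserved by the step above for x0 small. *)
Lemma gseries_bounded : exists x0 K : R,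
  [/\ 0 < x0, 0 < K & forall n, (gseries d n).[x0] <= K].
Proof.
pose h (t : R) := \prod_s (`|A s| + t).
pose g (t : R) := \prod_s (`|B s| + t).
have [y0 y0_gt0 hy0] : exists2 y0 : R, 0 < y0 & h y0 - alpha <= alpha / 2.
  have hE t : h t = (\prod_s (`|A s|%:P + 'X)).[t].
    by rewrite horner_prod; apply: eq_bigr => s _; rewrite !hornerE.
  have : {for 0, continuous h}.
    by rewrite (_ : h = fun t => (\prod_s (`|A s|%:P + 'X)).[t]);
      [exact: continuous_horner|exact/funext].
  move=> /cvgrPdist_le/(_ (alpha / 2))/(_ _)[|r /= r0 Hr]; first by rewrite divr_gt0.
  exists (r / 2); first by rewrite divr_gt0.
  have := Hr (r / 2); rewrite /= sub0r normrN gtr0_norm ?divr_gt0//.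
  rewrite ltr_pdivrMr// ltr_pMr// ltr1n => /(_ isT).
  have -> : h 0 = alpha by apply: eq_bigr => s _; rewrite addr0.
  by rewrite ler_norml => /andP[+ _]; lra.
have g_gt0 : 0 < g y0.
  by apply: prodr_gt0 => s _; rewrite ltr_wpDl.
(* x0 is chosen so that the first term of the step bound is alpha * y0 / 2 *)
pose x0 := alpha * y0 / 2 / ((1 + y0) * g y0).
have y01 : 0 < 1 + y0 by lra.
have x0_gt0 : 0 < x0 by rewrite !divr_gt0 ?mulr_gt0.
exists x0, y0; split => //; elim=> [|n IH].
  rewrite horner_gseries seriesEord/= big_ord0; exact: ltW.
set t := (gseries d n).[x0] in IH.
have t0 : 0 <= t.
  rewrite /t horner_gseries seriesEord/= sumr_ge0// => k _.
  by rewrite mulr_ge0// exprn_ge0// ltW.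
have := @horner_coefs_le _ _ _ x0 (ltW x0_gt0) (@gseries_step_bound n).
rewrite hornerZ -/t !(hornerD, hornerM, hornerN, hornerC, hornerX).
rewrite !horner_prod -/t => H.
have hE (H' : finType) (C : H' -> R) :
    \prod_s (`|C s|%:P + gseries d n).[x0] = \prod_s (`|C s| + t).
  by apply: eq_bigr => s _; rewrite !hornerE.
rewrite !hE -/(h t) -/(g t) in H.
have mono (H' : finType) (C : H' -> R) :
   \prod_s (`|C s| + t) <= \prod_s (`|C s| + y0).
  by apply: ler_prod => s _; rewrite addr_ge0//= lerD2l.
have ht : h t <= h y0 by exact: mono.
have gty : g t <= g y0 by exact: mono.
have g0 : 0 <= g t by rewrite prodr_ge0// => s _; rewrite addr_ge0.
have ha : alpha <= h t by apply: ler_prod => s _; rewrite normr_ge0/= lerDl.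
rewrite -(ler_pM2l alpha_gt0) (le_trans H)//.
have -> : alpha * y0 = x0 * ((1 + y0) * g y0) + y0 * (alpha / 2).
  by rewrite /x0 divfK ?gt_eqF ?mulr_gt0//; field.
apply: lerD.
  rewrite -mulrA ler_wpM2l ?(ltW x0_gt0)// ler_pM//; first by rewrite addr_ge0.
  by rewrite lerD2l.
rewrite ler_pM// ?subr_ge0//; lra.
Qed.

(** The sum of the series solves the equation, because the error at order n has
    order X^(n+1) and bounded majorants. *)
Lemma gsum_equation (x0 K x : R) : 0 < x0 ->
  (forall n, (gseries d n).[x0] <= K) -> `|x| < x0 ->
  gsum d x * \prod_t (A t + gsum d x) =
  x * (1 + gsum d x) * \prod_t (B t + gsum d x).
Proof.
move=> x0_gt0 dK xx0; set y := gsum d x.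
have K0 : 0 <= K.
  by apply: le_trans (dK 0); rewrite horner_gseries seriesEord/= big_ord0.
pose E n := gseries d n * \prod_t ((A t)%:P + gseries d n)
  - 'X * (1 + gseries d n) * \prod_t ((B t)%:P + gseries d n).
have cy : (gseries d n).[x] @[n --> \oo] --> y.
  by apply: (cvg_gsum d0 x0_gt0 dK); exact: ltW.
have cE : (E n).[x] @[n --> \oo] -->
    y * \prod_t (A t + y) - x * (1 + y) * \prod_t (B t + y).
  have prodE (H : finType) (C : H -> R) :
      (\prod_t ((C t)%:P + gseries d n)).[x] @[n --> \oo] --> \prod_t (C t + y).
    under eq_fun do rewrite horner_prod.
    apply: cvg_bigprod => t; under eq_fun do rewrite hornerD hornerC.
    by apply: cvgD => //; exact: cvg_cst.
  under eq_fun do rewrite /E !(hornerD, hornerN, hornerM, hornerC, hornerX).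
  apply: cvgB; first by apply: cvgM.
  apply: cvgM => //; apply: cvgM; first exact: cvg_cst.
  by apply: cvgD => //; exact: cvg_cst.
pose L := K * \prod_t (`|A t| + K) + x0 * (1 + K) * \prod_t (`|B t| + K).
have cE0 : (E n).[x] @[n --> \oo] --> (0 : R).
  suff H : `|(E n).[x]| @[n --> \oo] --> (0 : R) by apply/norm_cvg0P; exact: H.
  have r1 : `| `|x| / x0 | < 1.
    by rewrite ger0_norm ?divr_ge0 ?(ltW x0_gt0)// ltr_pdivrMr// mul1r.
  have c0 : (`|x| / x0) ^+ n.+1 * L @[n --> \oo] --> (0 : R).
    suff: (`|x| / x0) ^+ n.+1 * L @[n --> \oo] --> (0 * L : R) by rewrite mul0r.
    apply: cvgM; last exact: cvg_cst.
    have := cvg_expr r1; rewrite -(cvg_shiftS (fun n => (`|x| / x0) ^+ n)).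
    exact.
  suff Hs : \forall n \near \oo, (0 : R) <= `|(E n).[x]| <= (`|x| / x0) ^+ n.+1 * L.
    by apply: (squeeze_cvgr Hs); [exact: cvg_cst|exact: c0].
  near=> n.
  rewrite normr_ge0/=.
  have EW : majorized (E n) (gseries d n * \prod_t (`|A t|%:P + gseries d n)
     + 'X * (1 + gseries d n) * \prod_t (`|B t|%:P + gseries d n)).
    apply: majorizedD; last exact/majorizedN/majB.
    by apply: majorizedM => //; exact: majorized_gseries.
  have E0 : eqXn n (E n) 0.
    by move=> k kn; rewrite coefB (dE kn) subrr coef0.
  apply: (le_trans (majorized_horner_high EW E0 x0_gt0 (ltW xx0))).
  rewrite ler_wpM2l ?exprn_ge0 ?divr_ge0 ?(ltW x0_gt0)//.
  rewrite !(hornerD, hornerM, hornerX, hornerC) !horner_prod.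
  set t := (gseries d n).[x0].
  have t0 : 0 <= t.
    rewrite /t horner_gseries seriesEord/= sumr_ge0// => k _.
    by rewrite mulr_ge0// exprn_ge0// ltW.
  have hE (H' : finType) (C : H' -> R) :
    \prod_s (`|C s|%:P + gseries d n).[x0] <= \prod_s (`|C s| + K).
    apply: ler_prod => s _.
    by rewrite hornerD hornerC -/t addr_ge0//= lerD2l dK.
  have hp (H' : finType) (C : H' -> R) :
    0 <= \prod_s (`|C s|%:P + gseries d n).[x0].
    by apply: prodr_ge0 => s _; rewrite hornerD hornerC -/t addr_ge0.
  apply: lerD; first by apply: ler_pM => //; exact: dK.
  apply: ler_pM => //; first by rewrite mulr_ge0 ?addr_ge0// ltW.
  by rewrite ler_wpM2l ?(ltW x0_gt0)// lerD2l dK.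
by apply/eqP; rewrite -subr_eq0; apply/eqP; exact: cvg_unique _ cE cE0.
Unshelve. all: by end_near. Qed.

End algebraic_series.

(** * Local inversion and uniqueness of power series *)

Section power_series_uniqueness.
Variable R : realType.

Lemma cvg_bounded_coefs (e : nat -> R) (x0 K x : R) : 0 < x0 ->
  (forall k, `|e k| * x0 ^+ k <= K) -> `|x| <= x0 / 2 ->
  cvgn [series e k.+1 * x ^+ k.+1]_k.
Proof.
move=> x0_gt0 eK xx0; apply: normed_cvg.
have K0 : 0 <= K by apply: le_trans (eK 0); rewrite mulr_ge0// exprn_ge0// ltW.
apply: (@series_le_cvg _ _ (geometric (K / 2) 2^-1)).
- by move=> n; exact: normr_ge0.
- by move=> n; rewrite /= !mulr_ge0// exprn_ge0// invr_ge0.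
- move=> n; rewrite /= normrM normrX.
  apply: (@le_trans _ _ (`|e n.+1| * (x0 / 2) ^+ n.+1)).
    by rewrite ler_wpM2l// lerXn2r// nnegrE divr_ge0// ltW.
  have -> : K / 2 * 2^-1 ^+ n = K * 2^-1 ^+ n.+1 by rewrite exprS mulrA.
  by rewrite exprMn mulrA ler_wpM2r// exprn_ge0// invr_ge0.
- by apply: is_cvg_geometric_series; rewrite gtr0_norm ?invr_gt0// invf_lt1// ltr1n.
Qed.

(** Uniqueness of power series expansions, for coefficients of at most geometric
    growth. *)
Lemma gsum_eq0 (e : nat -> R) (x0 K : R) : 0 < x0 ->
  (forall k, `|e k| * x0 ^+ k <= K) ->
  (\forall x \near (0 : R), gsum e x = 0) ->
  forall k, (0 < k)%N -> e k = 0.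
Proof.
move=> x0_gt0 eK e0 k; have ecvg x := @cvg_bounded_coefs e x0 K x x0_gt0 eK.
elim/ltn_ind: k => k IH k0.
pose x1 := x0 / 2; have x1_gt0 : 0 < x1 by rewrite divr_gt0.
pose q n : {poly R} := \poly_(l < n.+1) `|e l|.
have qK n : (q n).[x1] <= 2 * K.
  rewrite horner_poly.
  have H : \sum_(l < n.+1) `|e l| * x1 ^+ l <= \sum_(l < n.+1) K * (2^-1) ^+ l.
    by apply: ler_sum => l _; rewrite exprMn mulrA ler_wpM2r ?exprn_ge0 ?invr_ge0.
  apply: (le_trans H); rewrite -mulr_sumr mulrC ler_wpM2r//.
    by apply: le_trans (eK 0); rewrite mulr_ge0// exprn_ge0// ltW.
  have -> : \sum_(l < n.+1) (2^-1 : R) ^+ l = 2 - 2^-1 ^+ n.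
    elim: n {H} => [|n IHn]; first by rewrite big_ord1 !expr0; ring.
    by rewrite big_ord_recr/= IHn exprS; field.
  by rewrite gerBl exprn_ge0// invr_ge0.
have K0 : 0 <= 2 * K.
  rewrite mulr_ge0//; apply: le_trans (eK 0); rewrite mulr_ge0// exprn_ge0// ltW.
have bound x : 0 < x -> x <= x1 -> gsum e x = 0 ->
    `|e k| <= x * (2 * K / x1 ^+ k.+1).
  move=> x_gt0 xx1 ex0.
  have xa : `|x| <= x1 by rewrite gtr0_norm.
  have H n : (k <= n)%N -> `|(gseries e n).[x] - e k * x ^+ k| <=
      (x / x1) ^+ k.+1 * (2 * K).
    move=> kn; have -> : (gseries e n).[x] - e k * x ^+ k =
        (gseries e n - e k *: 'X^k).[x] by rewrite !hornerE.
    have maj : majorized (gseries e n - e k *: 'X^k) (q n).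
      move=> l; rewrite coefB coefZ coefXn !coef_poly ltnS.
      have [->|lk] := eqVneq l k.
        by rewrite kn; case: k k0 {IH kn} => // k _; rewrite mulr1 subrr normr0.
      rewrite mulr0 subr0; case: ifP; rewrite ?normr0// => _.
      by case: l lk; rewrite ?normr0.
    have low : eqXn k (gseries e n - e k *: 'X^k) 0.
      move=> l lk; rewrite coefB coefZ coefXn coef0.
      have [->|lk'] := eqVneq l k.
        by rewrite coef_gseries ?k0// mulr1 subrr.
      rewrite mulr0 subr0; case: l lk lk' => [|l] lk lk'.
        by rewrite gseries0.
      by rewrite coef_gseries ?(leq_trans lk)// IH// ltn_neqAle lk'.
    apply: le_trans (majorized_horner_high maj low x1_gt0 xa) _.
    rewrite gtr0_norm// ler_wpM2l// exprn_ge0// divr_ge0// ltW//.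
  have c : `|(gseries e n).[x] - e k * x ^+ k| @[n --> \oo] --> `|0 - e k * x ^+ k|.
    apply: cvg_norm; apply: cvgB; last exact: cvg_cst.
    under eq_fun do rewrite horner_gseries.
    by rewrite -ex0; exact: ecvg.
  have : `|0 - e k * x ^+ k| <= (x / x1) ^+ k.+1 * (2 * K).
    apply: (ler_cvg_to c (cvg_cst _)); near=> n.
    by apply: H; near: n; exact: nbhs_infty_ge.
  rewrite sub0r normrN normrM normrX (gtr0_norm x_gt0).
  have -> : (x / x1) ^+ k.+1 * (2 * K) = x * (2 * K / x1 ^+ k.+1) * x ^+ k.
    rewrite expr_div_n exprS; field.
    by rewrite expf_neq0// gt_eqF.
  by rewrite ler_pM2r// exprn_gt0.
apply/eqP; rewrite -normr_le0; apply/ler_addgt0Pl => r r0; rewrite addr0.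
have [s /= s0 Hs] := e0.
pose M := 2 * K / x1 ^+ k.+1 + 1.
have M0 : 0 < M by rewrite ltr_wpDl// divr_ge0// exprn_ge0// ltW.
(* small enough for the hypothesis at x, for [bound], and for x * M <= r *)
pose x := Num.min (s / 2) (Num.min x1 (r / M)).
have x_gt0 : 0 < x by rewrite !lt_min !divr_gt0.
have /bound H : 0 < x by [].
apply: le_trans (H _ _) _.
- by rewrite /x !ge_min lexx orbT.
- apply: Hs; rewrite /= sub0r normrN gtr0_norm// gt_min.
  by rewrite ltr_pdivrMr// ltr_pMr// ltr1n.
- have xr : x <= r / M by rewrite /x !ge_min lexx !orbT.
  rewrite -(divfK (lt0r_neq0 M0) r) ler_pM ?(ltW x_gt0)//.
    by rewrite divr_ge0// exprn_ge0// ltW.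
  by rewrite /M lerDl.
Unshelve. all: by end_near. Qed.

End power_series_uniqueness.

(** In this section [x0] lies within the domain of convergence of the series,
    and the sum solves the algebraic equation there. *)
Section local_inverse.
Variable R : realType.
Variables (i j : nat) (A : 'I_i -> R) (B : 'I_j -> R) (d : nat -> R) (x0 K : R).
Hypothesis B0 : forall t, B t != 0.
Hypothesis d0 : forall k, 0 <= d k.
Hypothesis d1 : 0 < d 1.
Hypothesis x0_gt0 : 0 < x0.
Hypothesis dK : forall n, (gseries d n).[x0] <= K.
Hypothesis dE : forall x, `|x| < x0 ->
  gsum d x * \prod_t (A t + gsum d x) =
  x * (1 + gsum d x) * \prod_t (B t + gsum d x).

Let S (z : R) := (\prod_(r < i) (z + A r)) / \prod_(s < j) (z + B s).

(** The candidate inverse of the moment series, chi(z) = z / (z + 1) S(z). *)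
Definition inverse_branch (z : R) := z / (z + 1) * S z.

Let prodB_cont : continuous (fun z : R => \prod_(s < j) (z + B s)).
Proof.
move=> z; rewrite (_ : (fun _ => _) = horner (\prod_(s < j) ('X + (B s)%:P))).
  exact: continuous_horner.
by apply/funext => y; rewrite horner_prod; apply: eq_bigr => s _; rewrite !hornerE.
Qed.

Let prodA_cont : continuous (fun z : R => \prod_(s < i) (z + A s)).
Proof.
move=> z; rewrite (_ : (fun _ => _) = horner (\prod_(s < i) ('X + (A s)%:P))).
  exact: continuous_horner.
by apply/funext => y; rewrite horner_prod; apply: eq_bigr => s _; rewrite !hornerE.
Qed.

Let prodB0 : \prod_(s < j) (0 + B s) != 0.
Proof. by apply/prodf_neq0 => s _; rewrite add0r. Qed.

Let regular_near0 : \forall z \near (0 : R),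
  z + 1 != 0 /\ \prod_(s < j) (z + B s) != 0.
Proof.
have H1 : \forall z \near (0 : R), \prod_(s < j) (z + B s) != 0.
  have c : \prod_(s < j) (z + B s) @[z --> (0 : R)] --> (\prod_(s < j) (0 + B s) : R).
    exact: prodB_cont.
  exact: (cvgr_neq0 _ c prodB0).
have H2 : \forall z \near (0 : R), z + 1 != 0.
  have c : z + 1 @[z --> (0 : R)] --> (0 + 1 : R).
    by apply: cvgD; [exact: cvg_id|exact: cvg_cst].
  by apply: (cvgr_neq0 _ c); rewrite add0r oner_neq0.
by near=> z; split; near: z.
Unshelve. all: by end_near. Qed.

Lemma inverse_branch_continuous : {for 0, continuous inverse_branch}.
Proof.
have z1 : z @[z --> (0 : R)] --> (0 : R) by exact: cvg_id.
apply: cvgM; first apply: cvgM => //.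
  apply: cvgV; first by rewrite add0r oner_neq0.
  by apply: cvgD => //; exact: cvg_cst.
by apply: cvgM; [exact: prodA_cont|apply: cvgV => //; exact: prodB_cont].
Qed.

Let gsum_cont0 : gsum d x @[x --> 0] --> (0 : R).
Proof.
rewrite -[X in _ --> X](gsum0 d).
by apply: (gsum_continuous d0 x0_gt0 dK); rewrite normr0.
Qed.

Lemma gsumK : \forall x \near 0, inverse_branch (gsum d x) = x.
Proof.
near=> x.
have xx0 : `|x| < x0.
  by near: x; exists x0 => //= y /=; rewrite sub0r normrN.
have [n1 nB] : gsum d x + 1 != 0 /\ \prod_(s < j) (gsum d x + B s) != 0.
  near: x; exact: (gsum_cont0 regular_near0).
have := dE xx0.
under eq_bigr do rewrite addrC.
under [in RHS]eq_bigr do rewrite addrC.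
rewrite /inverse_branch /S => E.
rewrite mulrACA E -invfM; set b := \prod_(_ < j) _ in nB *.
by rewrite (addrC 1); field; rewrite nB n1.
Unshelve. all: by end_near. Qed.

(** The linear term d_1 x dominates near 0, so the sum changes sign at 0. *)
Lemma gsum_sign r : 0 < r -> exists x1 : R,
  [/\ 0 < x1, x1 < x0, x1 < r, 0 < gsum d x1 & gsum d (- x1) < 0].
Proof.
move=> r0; pose L := gsum d x0 - (gseries d 1).[x0].
have L0 : 0 <= L.
  have := gsum_tail d0 x0_gt0 dK 1 (x := x0); rewrite gtr0_norm// lexx => /(_ isT).
  by rewrite divff ?gt_eqF// expr1n mul1r; exact: le_trans.
pose x1 := Num.min (Num.min (r / 2) (x0 / 2)) (x0 ^+ 2 * d 1 / (2 * (L + 1))).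
have L1 : 0 < L + 1 by rewrite ltr_wpDl.
have x1_gt0 : 0 < x1 by rewrite !lt_min !divr_gt0// mulr_gt0// ?exprn_gt0.
have x1x0 : x1 < x0.
  have h : x0 / 2 < x0 by move: x0_gt0; lra.
  by rewrite !gt_min h orbT.
have x1r : x1 < r.
  have h : r / 2 < r by lra.
  by rewrite !gt_min h.
have x1L : x1 * L < x0 ^+ 2 * d 1.
  have : x1 <= x0 ^+ 2 * d 1 / (2 * (L + 1)) by rewrite ge_min lexx orbT.
  rewrite ler_pdivlMr ?mulr_gt0// => H.
  have : 0 < x1 * (L + 2) by rewrite mulr_gt0// ltr_wpDl.
  by move: H; lra.
have tail y : `|y| = x1 -> `|gsum d y - d 1 * y| < d 1 * x1.
  move=> yx1.
  have -> : d 1 * y = (gseries d 1).[y].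
    by rewrite horner_gseries seriesEord/= big_ord1 expr1.
  have yx0 : `|y| <= x0 by rewrite yx1 ltW.
  apply: le_lt_trans (gsum_tail d0 x0_gt0 dK 1 yx0) _.
  rewrite yx1 -/L expr_div_n mulrAC ltr_pdivrMr ?exprn_gt0//.
  by move: x1L; rewrite -(ltr_pM2l x1_gt0); lra.
exists x1; split=> //.
  by have := tail x1 (gtr0_norm x1_gt0); rewrite ltr_norml; lra.
have := tail (- x1); rewrite normrN gtr0_norm// => /(_ erefl).
by rewrite ltr_norml; lra.
Qed.

(** Every z near 0 is a value of the series by the intermediate value theorem,
    and [gsumK] then identifies its preimage. *)
Lemma inverse_branchK : \forall z \near 0, gsum d (inverse_branch z) = z.
Proof.
have [r /= r0 Hr] : \forall x \near 0, inverse_branch (gsum d x) = x by exact: gsumK.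
have [x1 [x1_gt0 x1x0 x1r Tp Tn]] := gsum_sign r0.
near=> z.
have zT : gsum d (- x1) <= z <= gsum d x1.
  by apply/andP; split; apply: ltW; near: z; [exact: lt_nbhsr|exact: lt_nbhsl].
have [|||c] := @IVT R (gsum d) (- x1) x1 z; first by lra.
- apply: continuous_in_subspaceT => x; rewrite inE/= in_itv/= => xx1.
  apply: (gsum_continuous d0 x0_gt0 dK).
  by apply: le_lt_trans x1x0; rewrite ler_norml.
- rewrite ge_min le_max; case/andP: zT => -> ->; by rewrite orbT.
rewrite in_itv/= -ler_norml => cx1 <-; rewrite Hr//=.
by rewrite sub0r normrN (le_lt_trans cx1).
Unshelve. all: by end_near. Qed.

Lemma gsum_inverse : inverse_near0 (gsum d) inverse_branch.
Proof.
by split; [exact: inverse_branch_continuous|exact: inverse_branchK|exact: gsumK].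
Qed.

(** A function inverse to a germ [f] and agreeing with [inverse_branch] forces
    [f] to be [gsum d]. *)
Lemma inverse_near0_unique (f g : R -> R) : f 0 = 0 -> inverse_near0 f g ->
  (\forall z \near 0^', S z = (z + 1) / z * g z) ->
  \forall x \near 0, f x = gsum d x.
Proof.
move=> f0 [_ fg gf] gS.
have g0 : g 0 = 0 by rewrite -[in LHS]f0; exact: (nbhs_singleton gf).
have gE : \forall z \near 0, g z = inverse_branch z.
  have : \forall z \near 0, z != 0 -> S z = (z + 1) / z * g z by exact: gS.
  move=> gS'; near=> z.
  have [->|z0] := eqVneq z 0; first by rewrite g0 /inverse_branch !mul0r.
  have [z1 _] : z + 1 != 0 /\ \prod_(s < j) (z + B s) != 0 by near: z.
  rewrite /inverse_branch (_ : S z = (z + 1) / z * g z); last first.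
    by move: z0; near: z.
  by field; rewrite z0 z1.
have H : \forall z \near 0, f (inverse_branch z) = z.
  by near=> z; rewrite -(_ : g z = inverse_branch z); near: z.
have H2 := gsum_cont0 H.
near=> x.
rewrite -[X in f X](_ : inverse_branch (gsum d x) = x); last first.
  by near: x; exact: gsumK.
by near: x; exact: H2.
Unshelve. all: by end_near. Qed.

End local_inverse.

(** * Averages over finite sequences and Riemann sums of monotone functions *)

Section averages.
Variable R : realType.
Implicit Types (s : seq R) (g h : R -> R).

(** The average of [g] over the sequence [s] (and 0 when [s] is empty). *)
Definition avg s g : R := (size s)%:R^-1 * \sum_(x <- s) g x.

Lemma le_avg s g h : {in s, forall x, g x <= h x} -> avg s g <= avg s h.
Proof.
move=> gh; rewrite ler_wpM2l ?invr_ge0// !big_seq.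
by apply: ler_sum => x /gh.
Qed.

Lemma avgD s g h : avg s (fun x => g x + h x) = avg s g + avg s h.
Proof. by rewrite /avg big_split mulrDr. Qed.

Lemma avgZ s (c : R) g : avg s (fun x => c * g x) = c * avg s g.
Proof. by rewrite /avg -mulr_sumr mulrCA. Qed.

Lemma avgB s g h : avg s (fun x => g x - h x) = avg s g - avg s h.
Proof. by rewrite /avg sumrB mulrBr. Qed.

Lemma avg_cst s (c : R) : (0 < size s)%N -> avg s (fun=> c) = c.
Proof.
move=> s0; rewrite /avg big_const_seq count_predT iter_addr_0.
rewrite -[X in _ * X]mulr_natl mulKf//.
by rewrite pnatr_eq0 -lt0n.
Qed.

Lemma ler_norm_avg s g : `|avg s g| <= avg s (fun x => `|g x|).
Proof.
rewrite /avg normrM ger0_norm ?invr_ge0// ler_wpM2l ?invr_ge0//.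
exact: ler_norm_sum.
Qed.

End averages.

(** The averages of the powers over the nonnegative sequences [L m] converge to
    [c], and [c k] grows at most like a multiple of x0^(-k). The cut-off T is at
    least twice the growth rate 1 / x0. *)
Section tails.
Variable R : realType.
Variables (L : nat -> seq R) (c : nat -> R) (x0 K T : R).
Hypothesis L0 : forall m, {in L m, forall x, 0 <= x}.
Hypothesis Lc : forall k, avg (L m) (fun x => x ^+ k) @[m --> \oo] --> c k.
Hypothesis x0_gt0 : 0 < x0.
Hypothesis cK : forall k, c k * x0 ^+ k <= K.
Hypothesis T_gt0 : 0 < T.
Hypothesis Tx0 : 2 <= T * x0.

(** The part of the moments beyond T is eventually small: it is bounded by
    c_(k+n) / T^n, and T exceeds the growth rate 1 / x0 of the limit moments. *)
Lemma avg_tail k e : 0 < e ->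
  \forall m \near \oo, avg (L m) (fun x => if T < x then x ^+ k else 0) <= e.
Proof.
move=> e0.
have [n ne] : exists n, c (k + n) / T ^+ n < e.
  have [n nK] : exists n, `|K / x0 ^+ k| * 2^-1 ^+ n < e.
    have H : `|2^-1 : R| < 1 by rewrite gtr0_norm ?invr_gt0//; lra.
    have : `|K / x0 ^+ k| * 2^-1 ^+ n @[n --> \oo] --> `|K / x0 ^+ k| * 0.
      by apply: cvgM; [exact: cvg_cst|exact: cvg_expr].
    by rewrite mulr0 => /cvgr_lt/(_ e e0)[n _ /(_ n (leqnn _))]; exists n.
  exists n; apply: le_lt_trans nK.
  rewrite ler_pdivrMr ?exprn_gt0//.
  have ck : c (k + n) <= `|K / x0 ^+ k| / x0 ^+ n.
    have -> : `|K / x0 ^+ k| / x0 ^+ n = `|K| / x0 ^+ (k + n).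
      rewrite normrM normfV (ger0_norm (exprn_ge0 _ (ltW x0_gt0))) exprD invfM.
      by rewrite mulrA.
    by rewrite ler_pdivlMr ?exprn_gt0// (le_trans (cK _))// ler_norm.
  apply: le_trans ck _; rewrite -mulrA ler_wpM2l//.
  have h : x0^-1 <= 2^-1 * T.
    by rewrite -[x0^-1]mul1r ler_pdivrMr//; move: Tx0; lra.
  rewrite -!exprVn -exprMn; apply: lerXn2r => //; rewrite nnegrE ?invr_ge0 ?ltW//.
  by rewrite mulr_gt0// invr_gt0.
have H := @Lc (k + n).
have : \forall m \near \oo, avg (L m) (fun x => x ^+ (k + n)) <= e * T ^+ n.
  by apply: (cvgr_le _ H); rewrite -ltr_pdivrMr ?exprn_gt0.
apply: filterS => m Hm.
apply: (@le_trans _ _ (avg (L m) (fun x => (T ^+ n)^-1 * x ^+ (k + n)))).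
  apply: le_avg => x xL; have x0' := L0 xL; case: ifPn => [Tx|_].
    rewrite mulrC ler_pdivlMr ?exprn_gt0// exprD ler_wpM2l ?exprn_ge0//.
    by rewrite lerXn2r ?nnegrE ?(ltW Tx) ?(ltW T_gt0).
  by rewrite mulr_ge0 ?exprn_ge0// invr_ge0 exprn_ge0// ltW.
by rewrite avgZ mulrC ler_pdivrMr ?exprn_gt0.
Qed.

Lemma avg_min k :
  avg (L m) (fun x => Num.min x T ^+ k) @[m --> \oo] --> c k.
Proof.
apply/cvgrPdist_le => e e0.
have e2 : 0 < e / 2 by rewrite divr_gt0.
have /cvgrPdist_le/(_ _ e2) H1 := @Lc k.
have H2 := @avg_tail k _ e2.
near=> m.
have h1 : `|c k - avg (L m) (fun x => x ^+ k)| <= e / 2 by near: m.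
have h2 : avg (L m) (fun x => if T < x then x ^+ k else 0) <= e / 2 by near: m.
have h3 : `|avg (L m) (fun x => x ^+ k) - avg (L m) (fun x => Num.min x T ^+ k)|
    <= e / 2.
  apply: le_trans h2; rewrite -avgB; apply: le_trans (ler_norm_avg _ _) _.
  apply: le_avg => x xL; have x0' := L0 xL.
  have [xT|Tx] := leP x T; first by rewrite subrr normr0.
  rewrite ger0_norm ?gerBl ?exprn_ge0 ?(ltW T_gt0)// subr_ge0.
  by rewrite lerXn2r ?nnegrE ?(ltW Tx) ?(ltW T_gt0).
by move: h1 h3; rewrite !ler_norml; lra.
Unshelve. all: by end_near. Qed.

End tails.

Section monotone_riemann.
Variable R : realType.
Let mu := @lebesgue_measure R.

(** Lower and upper Riemann sums of a nonnegative nondecreasing function. *)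
Lemma riemann_monotone (g : R -> R) n : (0 < n)%N ->
  {homo g : x y / x <= y} -> (forall x, 0 <= g x) ->
  ((n%:R^-1 * \sum_(l < n) g (l%:R / n%:R))%:E <= \int[mu]_(x in `[0%R, 1%R[) (g x)%:E
   <= (n%:R^-1 * \sum_(l < n) g (l.+1%:R / n%:R))%:E)%E.
Proof.
move=> n0 gh g0; have nr : (0 : R) < n%:R by rewrite ltr0n.
have mg D : measurable D -> measurable_fun D (fun x => (g x)%:E).
  by move=> mD; apply/measurable_EFinP; exact: nondecreasing_measurable.
have step k : (k <= n)%N ->
  ((n%:R^-1 * \sum_(l < k) g (l%:R / n%:R))%:E
    <= \int[mu]_(x in `[0%R, (k%:R / n%:R)%R[) (g x)%:E
    <= (n%:R^-1 * \sum_(l < k) g (l.+1%:R / n%:R))%:E)%E.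
  elim: k => [|k IH] kn.
    by rewrite mul0r set_itvco0 integral_set0 !big_ord0 mulr0 lexx.
  have kk : (k%:R / n%:R : R) <= k.+1%:R / n%:R.
    by rewrite ler_pM2r ?invr_gt0// ler_nat.
  have -> : `[0%R, (k.+1%:R / n%:R)%R[%classic =
     `[0%R, (k%:R / n%:R)%R[ `|` `[(k%:R / n%:R)%R, (k.+1%:R / n%:R)%R[%classic
     :> set R.
    by rewrite -itv_bndbnd_setU// bnd_simp// divr_ge0.
  rewrite ge0_integral_setU//=; last 3 first.
  - by apply: mg; exact: measurableU.
  - by move=> x _; rewrite lee_fin.
  - apply/disj_setPS => x [] /=; rewrite !in_itv/= => /andP[_ +] /andP[+ _].
    by move=> /lt_le_trans h /h; rewrite ltxx.
  rewrite !big_ord_recr/= !mulrDr !EFinD.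
  have mI : mu `[(k%:R / n%:R)%R, (k.+1%:R / n%:R)%R[%classic = (n%:R^-1)%:E.
    rewrite /mu lebesgue_measure_itv/= lte_fin ltr_pM2r ?invr_gt0// ltr_nat ltnSn.
    by rewrite -EFinB -mulrBl -natrB// subSnn mul1r.
  have /andP[IH1 IH2] := IH (ltnW kn).
  apply/andP; split; apply: leeD => //.
    rewrite mulrC EFinM -mI -integral_cst//; apply: ge0_le_integral => //=.
    - by move=> x _; rewrite lee_fin.
    - exact: mg.
    - by move=> x; rewrite in_itv/= => /andP[xk _]; rewrite lee_fin gh.
  rewrite [n%:R^-1 * _]mulrC EFinM -mI -integral_cst//; apply: ge0_le_integral => //=.
  - by move=> x _; rewrite lee_fin.
  - exact: mg.
  - by move=> x; rewrite in_itv/= => /andP[_ /ltW xk]; rewrite lee_fin gh.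
by have := step n (leqnn n); rewrite divff ?gt_eqF.
Qed.

(** The integral over the unit interval, as a real number. *)
Definition integral01 (g : R -> R) : R := fine (\int[mu]_(x in `[0%R, 1%R[) (g x)%:E).

(** For monotone functions the error of a Riemann sum depends only on the bound
    of the function. *)
Lemma riemann_monotone_dist (g : R -> R) (C : R) n : (0 < n)%N ->
  {homo g : x y / x <= y} -> (forall x, 0 <= g x <= C) ->
  `|integral01 g - n%:R^-1 * \sum_(l < n) g (l%:R / n%:R)| <= C / n%:R.
Proof.
move=> n0 gh g0C; have nr : (0 : R) < n%:R by rewrite ltr0n.
have g0 x : 0 <= g x by have /andP[] := g0C x.
have /andP[] := riemann_monotone n0 gh g0; rewrite /integral01.
set I0 := integral _ _ _; case: I0 => [r | |] //; rewrite /= !lee_fin => h1 h2.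
have h3 : \sum_(l < n) g (l.+1%:R / n%:R) =
    \sum_(l < n) g (l%:R / n%:R) + (g 1 - g 0).
  case: n n0 {h1 h2} nr => // n _ nr.
  rewrite big_ord_recr [in RHS]big_ord_recl/= divff ?gt_eqF// mul0r.
  under [in RHS]eq_bigr do rewrite /bump/= add1n.
  by ring.
have h4 : n%:R^-1 * (g 1 - g 0) <= C / n%:R.
  rewrite mulrC ler_wpM2r ?invr_ge0//.
  by have /andP[_] := g0C 1; have := g0 0; lra.
by move: h2; rewrite h3 mulrDr ler_norml => h2; apply/andP; split; lra.
Qed.

End monotone_riemann.

(** * A limit probability measure by quantile functions *)

Section quantiles.
Variable R : realType.
Implicit Types (s : seq R) (T u : R).

(** The quantile function of the empirical distribution of [s] truncated at T:
    the entry of index floor(u * size s) in the sorted sequence. The default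
    value T keeps the function nondecreasing on the whole line. *)
Definition quantile T s u : R :=
  nth T (sort <=%O [seq Num.min x T | x <- s]) (Num.trunc (u * (size s)%:R)).

Lemma quantile_bounds T s u : 0 <= T -> {in s, forall x, 0 <= x} ->
  0 <= quantile T s u <= T.
Proof.
move=> T0 s0; rewrite /quantile; set r := sort _ _; set l := Num.trunc _.
have [lr|rl] := ltnP l (size r); last by rewrite nth_default// T0 lexx.
have : nth T r l \in [seq Num.min x T | x <- s] by rewrite -(mem_sort <=%O) mem_nth.
move=> /mapP[x xs ->].
by rewrite le_min s0// T0 ge_min lexx orbT.
Qed.

Lemma quantile_homo T s : 0 <= T -> {in s, forall x, 0 <= x} ->
  {homo quantile T s : u v / u <= v}.
Proof.
move=> T0 s0 u v uv.
have /andP[_ uT] := quantile_bounds u T0 s0.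
rewrite {2}/quantile; set r := sort _ _; set l := Num.trunc _.
have [lr|rl] := ltnP l (size r); last by rewrite nth_default.
have kl : (Num.trunc (u * (size s)%:R) <= l)%N by rewrite le_truncn// ler_wpM2r.
rewrite /quantile -/r; apply: (sorted_leq_nth le_trans le_refl) => //.
- exact: (sort_le_sorted [seq Num.min x T | x <- s]).
- by rewrite inE (leq_ltn_trans kl).
Qed.

Lemma quantile_sum T s (g : R -> R) :
  \sum_(l < size s) g (quantile T s (l%:R / (size s)%:R)) =
  \sum_(x <- s) g (Num.min x T).
Proof.
have [->|s0] := eqVneq s [::]; first by rewrite big_nil big_ord0.
have sz : ((size s)%:R : R) != 0 by rewrite pnatr_eq0 size_eq0.
transitivity (\sum_(x <- sort <=%O [seq Num.min x T | x <- s]) g x).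
  rewrite (big_nth T) size_sort size_map big_mkord; apply: eq_bigr => l _.
  by rewrite /quantile divfK// natrK.
by rewrite (perm_big [seq Num.min x T | x <- s]) ?perm_sort// big_map.
Qed.

End quantiles.

Section ultrafilter_limits.

Lemma ultra_fmap (S S' : Type) (f : S -> S') (U : set_system S) :
  UltraFilter U -> UltraFilter (f @ U).
Proof.
move=> UU; have UP := @ultra_proper _ _ UU.
split; first exact: fmap_proper_filter.
move=> G GP sub; apply/seteqP; split => // A GA.
have [//|UC] := in_ultra_setVsetC (f @^-1` A) UU.
exfalso; apply: (@filter_not_empty _ G _).
rewrite -(setICr A); apply: filterI => //.
by apply: sub.
Qed.

(** Bounded real functions converge along any ultrafilter. *)
Lemma ultra_bounded_cvg (R : realType) (S : Type) (U : set_system S) (f : S -> R) T :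
  UltraFilter U -> (forall m, 0 <= f m <= T) ->
  exists2 y, 0 <= y <= T & f m @[m --> U] --> y.
Proof.
move=> UU fT; have UP := @ultra_proper _ _ UU.
have cpt : compact `[0, T]%classic by exact: (@segment_compact R 0 T).
rewrite compact_ultra in cpt.
have fU : U (f @^-1` `[0, T]%classic).
  by apply: filterE => m /=; rewrite in_itv/=; exact: fT.
have [y [/= + fy]] := cpt _ (ultra_fmap f UU) fU.
by rewrite in_itv/= => y0T; exists y.
Qed.

End ultrafilter_limits.

Section existence.
Variable R : realType.
Variables (L : nat -> seq R) (c : nat -> R) (x0 K T : R).
Hypothesis L0 : forall m, {in L m, forall x, 0 <= x}.
Hypothesis Ls : forall m, (m <= size (L m))%N.
Hypothesis Lc : forall k, avg (L m) (fun x => x ^+ k) @[m --> \oo] --> c k.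
Hypothesis x0_gt0 : 0 < x0.
Hypothesis cK : forall k, c k * x0 ^+ k <= K.
Hypothesis T_gt0 : 0 < T.
Hypothesis Tx0 : 2 <= T * x0.

(** The quantile functions converge pointwise along an ultrafilter, and the
    integrals of their powers follow by comparison with Riemann sums. *)
Lemma limit_quantile : exists Y : R -> R,
  [/\ {homo Y : u v / u <= v}, forall u, 0 <= Y u <= T
    & forall k, integral01 (fun u => Y u ^+ k) = c k].
Proof.
have T0 : 0 <= T by exact: ltW.
have [U [UU sU]] := @ultraFilterLemma nat \oo _.
have UP := @ultra_proper _ _ UU.
have H u : exists y, 0 <= y <= T /\ quantile T (L m) u @[m --> U] --> y.
  have [|y y0 yc] := @ultra_bounded_cvg R nat U (fun m => quantile T (L m) u) T UU.
    by move=> m; exact: quantile_bounds.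
  by exists y.
have [Y YP] := choice H.
have Y0 u : 0 <= Y u <= T by have [] := YP u.
have Yc u : quantile T (L m) u @[m --> U] --> Y u by have [] := YP u.
have Yh : {homo Y : u v / u <= v}.
  move=> u v uv; apply: (ler_cvg_to (Yc u) (Yc v)); near=> m.
  exact: quantile_homo.
exists Y; split=> // k.
have powh (Z : R -> R) : {homo Z : u v / u <= v} -> (forall u, 0 <= Z u <= T) ->
    {homo (fun u => Z u ^+ k) : u v / u <= v} /\ (forall u, 0 <= Z u ^+ k <= T ^+ k).
  move=> Zh Z0; split=> [u v uv|u].
    have /andP[h1 _] := Z0 u; have /andP[h2 _] := Z0 v.
    by rewrite lerXn2r// Zh.
  have /andP[h1 h2] := Z0 u.
  by rewrite exprn_ge0//= lerXn2r// nnegrE.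
(* compare the average at m with the Riemann sum of step 1/n, both being close
   to the integral of the quantile function, then let m go to infinity *)
have key n : (0 < n)%N -> `|c k - n%:R^-1 * \sum_(l < n) Y (l%:R / n%:R) ^+ k|
    <= T ^+ k / n%:R.
  move=> n0.
  pose D m := avg (L m) (fun x => Num.min x T ^+ k) -
      n%:R^-1 * \sum_(l < n) quantile T (L m) (l%:R / n%:R) ^+ k.
  have c1 : D m @[m --> U] --> c k - n%:R^-1 * \sum_(l < n) Y (l%:R / n%:R) ^+ k.
    apply: cvgB.
      apply: cvg_trans; last exact: (avg_min L0 Lc x0_gt0 cK T_gt0 Tx0).
      by move=> A; apply: sU.
    apply: cvgM; first exact: cvg_cst.
    apply: (@cvg_big R 'I_n +%R 0 xpredT (@add_continuous _) _ U (index_enum 'I_n)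
      (fun l m => quantile T (L m) (l%:R / n%:R) ^+ k)) => l _.
    exact: cvg_comp (Yc _) (@exprn_continuous R k _).
  have c2 : T ^+ k / m%:R @[m --> \oo] --> (0 : R).
    suff : T ^+ k * m%:R^-1 @[m --> \oo] --> (T ^+ k * 0 : R) by rewrite mulr0.
    apply: cvgM; first exact: cvg_cst.
    by rewrite -(cvg_shiftS (fun m => m%:R^-1 : R)); exact: cvg_harmonic.
  have c3 : T ^+ k / m%:R + T ^+ k / n%:R @[m --> U] --> (0 + T ^+ k / n%:R : R).
    apply: cvgD; last exact: cvg_cst.
    apply: cvg_trans; last exact: c2.
    by move=> A; apply: sU.
  rewrite -[leRHS]add0r; apply: (ler_cvg_to (cvg_norm c1) c3).
  have : U [set m | (0 < m)%N] by apply: sU; exact: nbhs_infty_gt.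
  apply: filterS => m /= m0.
  have s0 : (0 < size (L m))%N by exact: leq_trans (Ls m).
  have qb u : 0 <= quantile T (L m) u <= T by exact: quantile_bounds.
  have [qh qb'] := powh _ (quantile_homo T0 (L0 (m := m))) qb.
  have := riemann_monotone_dist s0 qh qb'; have := riemann_monotone_dist n0 qh qb'.
  rewrite (quantile_sum T (L m) (fun x => x ^+ k)) -/(avg _ _).
  set I := integral01 _ => h1 h2.
  have h3 : T ^+ k / (size (L m))%:R <= T ^+ k / m%:R.
    by rewrite ler_wpM2l ?exprn_ge0// lef_pV2 ?posrE ?ltr0n// ler_nat.
  by move: h1 h2; rewrite /D /avg !ler_norml; lra.
have [Yh' Yb'] := powh _ Yh Y0.
apply/eqP; rewrite -subr_eq0 -normr_le0; apply/ler_addgt0Pl => e e0; rewrite addr0.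
have [n nE] : exists n, 2 * T ^+ k / n.+1%:R <= e.
  exists (Num.trunc (2 * T ^+ k / e)).
  rewrite ler_pdivrMr ?ltr0n// -ler_pdivrMl// mulrC ltW//.
  exact: truncnS_gt.
have h1 := key n.+1 isT; have h2 := riemann_monotone_dist (ltn0Sn n) Yh' Yb'.
apply: le_trans nE.
have -> : 2 * T ^+ k / n.+1%:R = T ^+ k / n.+1%:R + T ^+ k / n.+1%:R by ring.
rewrite distrC in h1; apply: le_trans (lerD h2 h1).
by apply: le_trans (ler_normD _ _); rewrite addrA subrK.
Unshelve. all: by end_near. Qed.

(** The law of the limit quantile function under the uniform distribution. *)
Lemma probability_with_moments : exists mu : probability R R,
  mu `[0, T]%classic = 1%E /\ forall k, moment mu k = c k.
Proof.
have [Y [Yh Y0 Yk]] := limit_quantile.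
have mY : measurable_fun (setT : set (measurableTypeR R)) Y.
  exact: nondecreasing_measurable.
pose P : probability (measurableTypeR R) R := @uniform_prob R 0 1 ltr01.
pose X : {RV P >-> R} := @mfun_Sub _ _ (measurableTypeR R) R Y (mem_set mY).
exists (distribution P X : probability R R); split.
  rewrite /distribution /pushforward/= (_ : _ @^-1` _ = setT) ?probability_setT//.
  by apply/seteqP; split => // u _ /=; rewrite in_itv/=.
move=> k; rewrite -Yk /moment /Rintegral /integral01.
have mE : measurable_fun setT (fun x : R => (x ^+ k)%:E).
  by apply/measurable_EFinP; exact: exprn_measurable.
have YE x : 0 <= Y x ^+ k by rewrite exprn_ge0//; have /andP[] := Y0 x.
have mYk D : measurable D -> measurable_fun D (fun x : R => (Y x ^+ k)%:E).
  move=> mD; apply/measurable_EFinP; apply: measurable_funX.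
  exact: nondecreasing_measurable.
congr fine.
have intY : P.-integrable setT ((fun x : R => (x ^+ k)%:E) \o X).
  rewrite (_ : _ \o _ = EFin \o (fun x => Y x ^+ k))//.
  apply: measurable_bounded_integrable => //.
  - by apply: le_lt_trans (probability_le1 P measurableT) _; rewrite ltry.
  - by apply: measurable_funX.
  - exists (T ^+ k); split; first exact: num_real.
    move=> t tT x _ /=; have /andP[h1 h2] := Y0 x.
    rewrite ger0_norm// (le_trans _ (ltW tT))// lerXn2r// nnegrE.
    exact: le_trans h2.
rewrite integral_distribution//.
transitivity (\int[P]_x (Y x ^+ k)%:E)%E; first by [].
rewrite integral_uniform//; last exact: mYk.
by rewrite subr0 invr1 mul1e integral_itv_bndo_bndc//; exact: mYk.
Qed.

End existence.

(** * Approximation by Bernstein polynomials *)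

Section weierstrass.
Variable R : realType.
Implicit Types (g h : nat -> R) (x y : R).

(** The Bernstein polynomial of [g], defined by the recursion of the binomial
    distribution: its value at x is the expectation of [g] at a binomial random
    variable with parameters n and x. *)
Fixpoint bernstein n g : {poly R} :=
  if n is n'.+1 then
    (1 - 'X) * bernstein n' g + 'X * bernstein n' (fun k => g k.+1)
  else (g 0)%:P.

Lemma bernsteinS n g x : (bernstein n.+1 g).[x] =
  (1 - x) * (bernstein n g).[x] + x * (bernstein n (fun k => g k.+1)).[x].
Proof. by rewrite /= !hornerE. Qed.

Lemma bernstein_lin n (a : R) g h x :
  (bernstein n (fun k => a * g k + h k)).[x] =
  a * (bernstein n g).[x] + (bernstein n h).[x].
Proof.
elim: n g h => [|n IH] g h; first by rewrite /= !hornerC.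
by rewrite !bernsteinS !IH; ring.
Qed.

Lemma bernstein_cst n (a x : R) : (bernstein n (fun=> a)).[x] = a.
Proof.
elim: n => [|n IH]; first by rewrite /= hornerC.
by rewrite bernsteinS IH; ring.
Qed.

Lemma bernstein_le n g h x : 0 <= x <= 1 ->
  (forall k, (k <= n)%N -> g k <= h k) ->
  (bernstein n g).[x] <= (bernstein n h).[x].
Proof.
move=> /andP[x0 x1]; elim: n g h => [|n IH] g h gh.
  by rewrite /= !hornerC gh.
rewrite !bernsteinS lerD// ler_wpM2l ?subr_ge0//; apply: IH => k kn; apply: gh => //.
exact: leqW.
Qed.

Lemma bernstein_id n x : (bernstein n (fun k => k%:R)).[x] = n%:R * x.
Proof.
elim: n => [|n IH]; first by rewrite /= hornerC mul0r.
rewrite bernsteinS IH.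
have -> : (fun k => k.+1%:R) = (fun k => 1 * k%:R + (fun=> 1) k) :> (nat -> R).
  by apply/funext => k; rewrite mul1r natr1.
by rewrite bernstein_lin IH bernstein_cst -natr1; ring.
Qed.

Lemma bernstein_sq n x : (bernstein n (fun k => k%:R ^+ 2)).[x] =
  n%:R * x * (1 - x) + (n%:R * x) ^+ 2.
Proof.
elim: n => [|n IH]; first by rewrite /= hornerC; ring.
rewrite bernsteinS IH.
have -> : (fun k => k.+1%:R ^+ 2) =
    (fun k => 1 * k%:R ^+ 2 + (fun k => 2 * k%:R + (fun=> 1) k) k) :> (nat -> R).
  by apply/funext => k; rewrite -natr1; ring.
by rewrite !bernstein_lin IH bernstein_cst bernstein_id -natr1; ring.
Qed.

Lemma bernstein_variance n x : (bernstein n (fun k => (k%:R - n%:R * x) ^+ 2)).[x] =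
  n%:R * x * (1 - x).
Proof.
have -> : (fun k => (k%:R - n%:R * x) ^+ 2) =
    (fun k => (- 2 * n%:R * x) * k%:R +
      (fun k => 1 * k%:R ^+ 2 + (fun=> (n%:R * x) ^+ 2) k) k) :> (nat -> R).
  by apply/funext => k; ring.
by rewrite !bernstein_lin bernstein_cst bernstein_id bernstein_sq; ring.
Qed.

Lemma bernstein_dist n g h (a : R) x : 0 <= x <= 1 ->
  (forall k, `|g k - a| <= h k) ->
  `|(bernstein n g).[x] - a| <= (bernstein n h).[x].
Proof.
move=> x01 gh.
have up : (bernstein n g).[x] <= (bernstein n (fun k => 1 * h k + (fun=> a) k)).[x].
  by apply: bernstein_le => // k _; have := gh k; rewrite ler_norml; lra.
have lo : (bernstein n (fun k => - 1 * h k + (fun=> a) k)).[x] <= (bernstein n g).[x].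
  by apply: bernstein_le => // k _; have := gh k; rewrite ler_norml; lra.
move: up lo; rewrite !bernstein_lin !bernstein_cst ler_norml.
by move=> up lo; apply/andP; split; lra.
Qed.

Lemma continuous_uniform (f : R -> R) (T e : R) : continuous f -> 0 < e ->
  exists2 r, 0 < r & forall x y, 0 <= x <= T -> `|x - y| < r -> `|f x - f y| <= e.
Proof.
move=> fc e0.
have e2 : 0 < e / 2 by rewrite divr_gt0.
have := (compact_near_coveringP `[0, T]%classic).1 (@segment_compact R 0 T).
move=> /(_ R (nbhs (0 : R)) (fun r x => forall y, `|x - y| < r -> `|f x - f y| <= e) _).
case.
  move=> x _; have /cvgrPdist_le/(_ _ e2)[r /= r0 Hr] := fc x.
  have r2 : 0 < r / 2 by rewrite divr_gt0.
  exists (ball x (r / 2), ball (0 : R) (r / 2)).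
    by split; exact: nbhsx_ballx.
  move=> [z s] [/= xz]; rewrite /ball/= sub0r normrN => sr y zy.
  have h1 := Hr z; have h2 := Hr y.
  have sr' : s < r / 2 by exact: le_lt_trans (ler_norm _) sr.
  rewrite /ball /= in xz.
  have xz' : `|x - z| < r by apply: lt_trans xz _; lra.
  have xy : `|x - y| < r.
    rewrite -(subrK z x) -addrA; apply: (le_lt_trans (ler_normD _ _)). lra.
  have := h1 xz'; have := h2 xy; rewrite !ler_norml; lra.
move=> r /= r0 Hr; exists (r / 2); first by rewrite divr_gt0.
move=> x y xT; apply: (Hr (r / 2)); last by rewrite /= in_itv.
by rewrite /= sub0r normrN gtr0_norm ?divr_gt0//; lra.
Qed.

(** The Weierstrass approximation theorem on [0, T], by the variance estimate
    for Bernstein polynomials. *)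
Lemma weierstrass (f : R -> R) (T H e : R) : continuous f -> 0 < T -> 0 < e ->
  (forall x, `|f x| <= H) ->
  exists q : {poly R}, forall x, 0 <= x <= T -> `|f x - q.[x]| <= e.
Proof.
move=> fc T0 e0 fH.
have H0 : 0 <= H by apply: le_trans (fH 0).
have e2 : 0 < e / 2 by rewrite divr_gt0.
have [r r0 Hr] := @continuous_uniform f T _ fc e2.
(* where |x - T k/n| >= r, the oscillation 2 H is at most
   2 H (x - T k/n)^2 / r^2, whose mean is controlled by the variance *)
pose M := 2 * H / r ^+ 2 * T ^+ 2.
have M0 : 0 <= M by rewrite !mulr_ge0 ?invr_ge0 ?exprn_ge0// ltW.
pose n := (Num.trunc (2 * M / e)).+1.
have n0 : (0 : R) < n%:R by rewrite ltr0n.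
have nE : M / n%:R <= e / 2.
  rewrite ler_pdivrMr// -ler_pdivrMl// invf_div mulrC mulrA (mulrC M) ltW//.
  exact: truncnS_gt.
pose g k := f (T * (k%:R / n%:R)).
exists (bernstein n g \Po (T^-1 *: 'X)) => x /andP[x0 xT].
rewrite horner_comp hornerZ hornerX; set y := T^-1 * x.
have y01 : 0 <= y <= 1.
  by rewrite /y mulr_ge0 ?invr_ge0 ?(ltW T0)//= mulrC ler_pdivrMr// mul1r.
have xE : x = T * y by rewrite /y mulrA divff ?mul1r// gt_eqF.
have bound k : `|g k - f x| <= e / 2 + M / n%:R ^+ 2 * (k%:R - n%:R * y) ^+ 2.
  have MM : 0 <= M / n%:R ^+ 2 * (k%:R - n%:R * y) ^+ 2.
    by rewrite mulr_ge0 ?sqr_ge0// mulr_ge0 ?invr_ge0 ?sqr_ge0.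
  have [xr|rx] := ltP `|x - T * (k%:R / n%:R)| r.
    rewrite distrC; apply: le_trans (Hr x _ _ xr) _; first by rewrite x0.
    by rewrite lerDl.
  apply: (@le_trans _ _ (2 * H)).
    apply: le_trans (ler_normB _ _) _; rewrite /g.
    by have := fH x; have := fH (T * (k%:R / n%:R)); lra.
  apply: (@le_trans _ _ (M / n%:R ^+ 2 * (k%:R - n%:R * y) ^+ 2)); last first.
    by rewrite lerDr ltW.
  have -> : M / n%:R ^+ 2 * (k%:R - n%:R * y) ^+ 2 =
      2 * H * ((x - T * (k%:R / n%:R)) ^+ 2 / r ^+ 2).
    by rewrite xE /M; field; rewrite !gt_eqF.
  rewrite ler_peMr ?mulr_ge0// ler_pdivlMr ?exprn_gt0// mul1r.
  rewrite -(ger0_norm (sqr_ge0 (_ - _))).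
  by rewrite normrX lerXn2r// nnegrE ltW.
rewrite distrC; apply: (le_trans (@bernstein_dist n g _ (f x) y y01 bound)).
rewrite (_ : (fun k => _) =
    (fun k => M / n%:R ^+ 2 * (k%:R - n%:R * y) ^+ 2 + (fun=> e / 2) k));
  last by apply/funext => k; rewrite addrC.
rewrite bernstein_lin bernstein_cst bernstein_variance.
have yy : y * (1 - y) <= 1.
  case/andP: y01 => y0 y1; have : 0 <= (1 - y) ^+ 2 by exact: sqr_ge0.
  by rewrite expr2; lra.
have -> : M / n%:R ^+ 2 * (n%:R * y * (1 - y)) = M / n%:R * (y * (1 - y)).
  by field; rewrite gt_eqF.
have : M / n%:R * (y * (1 - y)) <= M / n%:R by rewrite ler_piMr// divr_ge0// ltW.
by move: nE; lra.
Qed.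

End weierstrass.

(** * Compactly supported measures and convergence of averages *)

Section compact_support.
Variable R : realType.
Variables (mu : probability R R) (T : R).
Hypothesis muT : mu `[0, T]%classic = 1%E.
Implicit Types (f g : R -> R).

Let D : set R := `[0, T]%classic.
Let mD : measurable D. Proof. exact: measurable_itv. Qed.
Let muD : fine (mu D) = 1. Proof. by rewrite muT. Qed.

Lemma support_null : mu (~` D) = 0%E.
Proof. by rewrite probability_setC// muT subee. Qed.

Lemma support_T_ge0 : 0 <= T.
Proof.
have [//|T0] := leP 0 T; have := muT.
rewrite set_itv_ge ?bnd_simp ?leNgt ?T0// measure0 => /esym/eqP.
by rewrite onee_eq0.
Qed.

Lemma support_bounded_integrable f (C : R) : measurable_fun setT f ->
  (forall x, D x -> `|f x| <= C) -> mu.-integrable D (EFin \o f).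
Proof.
move=> mf fC; apply: measurable_bounded_integrable => //.
- by apply: le_lt_trans (probability_le1 mu mD) _; rewrite ltry.
- exact: measurable_funTS.
- exists C; split; first exact: num_real.
  by move=> t tC x Dx /=; rewrite (le_trans (fC _ Dx))// ltW.
Qed.

(** Integrals of functions bounded on the support reduce to the support. *)
Lemma support_integral f (C : R) : measurable_fun setT f ->
  (forall x, D x -> `|f x| <= C) ->
  (\int[mu]_x (f x)%:E)%E = (\int[mu]_(x in D) f x)%:E.
Proof.
move=> mf fC.
have DE : D = setT `\` (~` D) by rewrite setTD setCK.
have intD := support_bounded_integrable mf fC.
have intT : mu.-integrable setT (EFin \o f).
  apply/(@negligible_integrable _ _ _ mu setT (~` D)) => //.
  - exact: measurableC.
  - exact/measurable_EFinP.
  - exact: support_null.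
  - by rewrite -DE.
rewrite (@negligible_integral _ _ _ mu setT (~` D))//; last 2 first.
- exact: measurableC.
- exact: support_null.
rewrite -DE fineK//; exact: integrable_fin_num.
Qed.

Lemma support_Rintegral f (C : R) : measurable_fun setT f ->
  (forall x, D x -> `|f x| <= C) ->
  \int[mu]_x f x = \int[mu]_(x in D) f x.
Proof. by move=> mf fC; rewrite /Rintegral (support_integral mf fC). Qed.

Lemma horner_measurable (q : {poly R}) : measurable_fun setT (fun x => q.[x]).
Proof. by apply: continuous_measurable_fun; exact: continuous_horner. Qed.

Let coef_sum (q : {poly R}) := \sum_(k < size q) `|q`_k|.

Lemma horner_support_bound (q : {poly R}) x : D x ->
  `|q.[x]| <= coef_sum q * Num.max 1 T ^+ size q.
Proof.
rewrite /D/= in_itv/= => /andP[x0 xT].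
rewrite horner_coef mulr_suml (le_trans (ler_norm_sum _ _ _))//.
apply: ler_sum => k _; rewrite normrM ler_wpM2l// normrX (ger0_norm x0).
have m1 : 1 <= Num.max 1 T by rewrite le_max lexx.
apply: (@le_trans _ _ (Num.max 1 T ^+ k)).
  apply: lerXn2r; rewrite ?nnegrE//; first exact: le_trans m1.
  by rewrite le_max xT orbT.
by rewrite ler_weXn2l// ltnW.
Qed.

Lemma moment_support k : moment mu k = \int[mu]_(x in D) (x ^+ k).
Proof.
rewrite /moment.
have := @horner_measurable 'X^k; under eq_fun do rewrite hornerXn.
move=> mX; apply: (support_Rintegral mX) => x Dx.
by have := horner_support_bound 'X^k Dx; rewrite hornerXn; exact.
Qed.

Lemma moment_bound k : `|moment mu k| <= T ^+ k.
Proof.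
rewrite moment_support.
have mX : measurable_fun setT (fun x : R => x ^+ k) by exact: exprn_measurable.
have bX x : D x -> `|x ^+ k| <= T ^+ k.
  rewrite /D/= in_itv/= => /andP[x0 xT]; rewrite normrX ger0_norm//.
  by rewrite lerXn2r// nnegrE support_T_ge0.
have iX := support_bounded_integrable mX bX.
apply: le_trans (le_normr_Rintegral mD iX) _.
have iN : mu.-integrable D (EFin \o (fun x => `|x ^+ k|)).
  apply: (@support_bounded_integrable _ (T ^+ k)).
    by apply: measurableT_comp.
  by move=> x Dx; rewrite normr_id bX.
have iC : mu.-integrable D (EFin \o (fun=> T ^+ k)).
  by apply: (@support_bounded_integrable _ `|T ^+ k|).
apply: le_trans (le_Rintegral mD iN iC bX) _.
by rewrite Rintegral_cst// muD mulr1.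
Qed.

Lemma integral_horner (q : {poly R}) :
  \int[mu]_(x in D) q.[x] = \sum_(k < size q) q`_k * moment mu k.
Proof.
have H n (p : {poly R}) : (size p <= n)%N ->
    \int[mu]_(x in D) p.[x] = \sum_(k < n) p`_k * moment mu k.
  elim: n p => [|n IH] p.
    rewrite leqn0 size_poly_eq0 => /eqP ->; rewrite big_ord0.
    under eq_Rintegral do rewrite horner0.
    by rewrite Rintegral_cst// mul0r.
  move=> pn; pose p' := take_poly n p.
  have pE : p = p' + p`_n *: 'X^n.
    apply/polyP => k; rewrite coefD coefZ coefXn coef_take_poly.
    have [kn|nk|->] := ltngtP k n; rewrite ?mulr0 ?addr0 ?add0r ?mulr1//.
    by rewrite nth_default// (leq_trans pn).
  rewrite big_ord_recr/= [in LHS]pE.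
  under eq_Rintegral do rewrite hornerD hornerZ hornerXn.
  rewrite RintegralD//; last 2 first.
  - exact: (support_bounded_integrable (horner_measurable p')
      (horner_support_bound p')).
  - have := @horner_measurable (p`_n *: 'X^n).
    move=> /support_bounded_integrable/(_ (horner_support_bound (p`_n *: 'X^n))).
    by under eq_fun do rewrite /= hornerZ hornerXn.
  rewrite RintegralZl//; last first.
    have := @horner_measurable 'X^n.
    move=> /support_bounded_integrable/(_ (horner_support_bound 'X^n)).
    by under eq_fun do rewrite /= hornerXn.
  rewrite -moment_support IH ?size_take_poly//; congr (_ + _).
  by apply: eq_bigr => k _; rewrite coef_take_poly ltn_ord.
exact: H.
Qed.

End compact_support.

Section avg_weak_convergence.
Variable R : realType.
Variables (L : nat -> seq R) (c : nat -> R) (x0 K : R).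
Hypothesis L0 : forall m, {in L m, forall x, 0 <= x}.
Hypothesis Ls : forall m, (m <= size (L m))%N.
Hypothesis Lc : forall k, avg (L m) (fun x => x ^+ k) @[m --> \oo] --> c k.
Hypothesis x0_gt0 : 0 < x0.
Hypothesis cK : forall k, c k * x0 ^+ k <= K.
Variables (mu : probability R R) (T0 : R).
Hypothesis muT0 : mu `[0, T0]%classic = 1%E.
Hypothesis mu_moment : forall k, moment mu k = c k.

(** Convergence of moments to those of a compactly supported measure implies
    weak convergence. *)
Lemma avg_weak_cvg (h : R -> R) (H : R) : continuous h -> (forall x, `|h x| <= H) ->
  avg (L m) h @[m --> \oo] --> \int[mu]_x h x.
Proof.
move=> hc hH.
have H0 : 0 <= H by apply: le_trans (hH 0).
(* large enough for the tail estimate and the support of mu; T >= 1 lets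
   x^(size q) dominate every monomial of [q] beyond T *)
pose T := Num.max (2 / x0) (Num.max T0 1).
have T1 : 1 <= T by rewrite !le_max lexx !orbT.
have T_gt0 : 0 < T by exact: lt_le_trans T1.
have T0T : T0 <= T by rewrite !le_max lexx orbT.
have Tx0 : 2 <= T * x0 by rewrite -ler_pdivrMr// le_max lexx.
have muT : mu `[0, T]%classic = 1%E.
  apply/eqP; rewrite eq_le probability_le1//= -muT0 le_measure ?inE//.
  by apply: subset_itvl; rewrite bnd_simp.
have mh : measurable_fun setT h by exact: continuous_measurable_fun.
rewrite (support_Rintegral muT mh (fun x _ => hH x)).
set D := `[0, T]%classic.
apply/cvgrPdist_le => e e0; have e4 : 0 < e / 4 by rewrite divr_gt0.
have [q hq] := weierstrass hc T_gt0 e4 hH.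
pose C := H + \sum_(k < size q) `|q`_k|.
have C0 : 0 <= C by rewrite addr_ge0// sumr_ge0.
have e4C : 0 < e / 4 / (C + 1) by rewrite divr_gt0// ltr_wpDl.
have tail := avg_tail L0 Lc x0_gt0 cK T_gt0 Tx0 (size q) e4C.
have cq : avg (L m) (fun x => q.[x]) @[m --> \oo] --> \int[mu]_(x in D) q.[x].
  rewrite (integral_horner muT).
  have -> : (fun m => avg (L m) (fun x => q.[x])) =
     (fun m => \sum_(k < size q) q`_k * avg (L m) (fun x => x ^+ k)).
    apply/funext => m; rewrite /avg.
    under eq_bigr do rewrite horner_coef.
    rewrite exchange_big/= mulr_sumr; apply: eq_bigr => k _.
    by rewrite -mulr_sumr mulrCA.
  apply: cvg_bigsum => k; apply: cvgM; first exact: cvg_cst.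
  by rewrite mu_moment.
have hqI : `|\int[mu]_(x in D) h x - \int[mu]_(x in D) q.[x]| <= e / 4.
  have mD : measurable D by exact: measurable_itv.
  have ih := support_bounded_integrable (T := T) mu mh (fun x _ => hH x).
  have iq := support_bounded_integrable mu (horner_measurable q)
    (@horner_support_bound _ T q).
  have md : measurable_fun setT (fun x => h x - q.[x]).
    by apply: measurable_funB => //; exact: horner_measurable.
  have bd x : D x -> `|h x - q.[x]| <= e / 4 by rewrite /D/= in_itv/=; exact: hq.
  have id := support_bounded_integrable mu md bd.
  rewrite -RintegralB//. have HH := le_normr_Rintegral mD id. apply: le_trans HH _.
  have iN : mu.-integrable D (EFin \o (fun x => `|h x - q.[x]|)).
    apply: (support_bounded_integrable mu (C := e / 4)).
      by apply: measurableT_comp.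
    by move=> x Dx; rewrite normr_id bd.
  have iC : mu.-integrable D (EFin \o (fun=> e / 4)).
    by apply: (support_bounded_integrable mu (C := `|e / 4|)).
  apply: le_trans (le_Rintegral mD iN iC bd) _.
  have e1 : fine (mu D) = 1 by rewrite muT.
  by rewrite Rintegral_cst// -[leRHS]mulr1 -e1; exact: lexx.
have /cvgrPdist_le/(_ _ e4) cq' := cq.
near=> m.
have h1 : `|\int[mu]_(x in D) q.[x] - avg (L m) (fun x => q.[x])| <= e / 4 by near: m.
have h2 : avg (L m) (fun x => if T < x then x ^+ size q else 0) <= e / 4 / (C + 1).
  by near: m.
have s0 : (0 < size (L m))%N.
  by apply: leq_trans (Ls m); near: m; exact: nbhs_infty_gt.
have h3 : `|avg (L m) h - avg (L m) (fun x => q.[x])| <= e / 4 + e / 4.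
  rewrite -avgB; apply: le_trans (ler_norm_avg _ _) _.
  apply: (@le_trans _ _ (avg (L m) (fun x => e / 4 +
      C * (if T < x then x ^+ size q else 0)))).
    apply: le_avg => x xL; have x0' := L0 xL.
    have [Tx|xT] := ltP T x; last by rewrite mulr0 addr0 hq// x0'.
    apply: (@le_trans _ _ (C * x ^+ size q)); last by rewrite lerDr ltW.
    have x1 : 1 <= x by apply: le_trans T1 (ltW Tx).
    apply: le_trans (ler_normB _ _) _; rewrite mulrDl lerD//.
      by apply: le_trans (hH x) _; rewrite ler_peMr// exprn_ege1.
    rewrite horner_coef mulr_suml (le_trans (ler_norm_sum _ _ _))//.
    apply: ler_sum => k _; rewrite normrM ler_wpM2l// normrX (ger0_norm x0').
    by rewrite ler_weXn2l// ltnW.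
  rewrite avgD avg_cst// avgZ lerD2l.
  apply: (@le_trans _ _ ((C + 1) * (e / 4 / (C + 1)))).
    apply: ler_pM => //; last by rewrite lerDl.
    by apply: mulr_ge0 => //; apply: sumr_ge0 => x _; case: ifP => // Tx;
      rewrite exprn_ge0// ltW// (lt_trans T_gt0).
  by rewrite mulrC divfK// gt_eqF// ltr_wpDl.
by move: hqI h1 h3; rewrite !ler_norml; lra.
Unshelve. all: by end_near. Qed.

End avg_weak_convergence.

(** * Root distributions and symmetrizations as integrals *)

Section signed_integrals.
Variable R : realType.
Implicit Types (f g : R -> R).

(** Bounded measurable real functions. *)
Definition bounded_measurable f :=
  measurable_fun setT f /\ exists C : R, forall x, `|f x| <= C.

(** An integral against a measure built from simpler ones is determined by its
    values on nonnegative functions, by subtracting the negative part. *)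
Lemma integral_from_nonneg (nu : {measure set R -> \bar R}) (Phi : (R -> R) -> R) :
  (forall g, bounded_measurable g -> (forall x, 0 <= g x) ->
    (\int[nu]_x (g x)%:E)%E = (Phi g)%:E) ->
  (forall f g, bounded_measurable f -> bounded_measurable g ->
    Phi (fun x => f x - g x) = Phi f - Phi g) ->
  forall f, bounded_measurable f -> (\int[nu]_x (f x)%:E)%E = (Phi f)%:E.
Proof.
move=> Phi_ge0 PhiB f [mf [C fC]].
pose fp x := Num.max (f x) 0; pose fn x := Num.max (- f x) 0.
have bp : bounded_measurable fp.
  split; first by apply: measurable_maxr => //; exact: measurable_cst.
  exists C => x; apply: le_trans (fC x); rewrite /fp ger0_norm ?le_max ?lexx ?orbT//.
  by rewrite ge_max ler_norm normr_ge0.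
have bn : bounded_measurable fn.
  split.
    by apply: measurable_maxr; [exact: measurableT_comp|exact: measurable_cst].
  exists C => x; apply: le_trans (fC x); rewrite /fn ger0_norm ?le_max ?lexx ?orbT//.
  by rewrite ge_max -normrN ler_norm normr_ge0.
rewrite integralE.
have -> : (\int[nu]_x ((fun x => (f x)%:E)^\+ x) = \int[nu]_x (fp x)%:E)%E.
  by apply: eq_integral => x _; rewrite funeposE /fp EFin_max.
have -> : (\int[nu]_x ((fun x => (f x)%:E)^\- x) = \int[nu]_x (fn x)%:E)%E.
  by apply: eq_integral => x _; rewrite funenegE /fn EFin_max.
rewrite !Phi_ge0//; last 2 first.
- by move=> x; rewrite /fn le_max lexx orbT.
- by move=> x; rewrite /fp le_max lexx orbT.
rewrite -EFinB -PhiB//; congr (Phi _)%:E; apply/funext => x.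
rewrite /fp /fn; have [f0|f0] := leP (f x) 0.
  by rewrite max_l ?oppr_ge0// sub0r opprK.
by rewrite max_r ?subr0// oppr_le0 ltW.
Qed.

End signed_integrals.

Section root_distribution.
Variable R : realType.
Implicit Types (p : {poly R[i]}) (f : R -> R).

Lemma poly_rootsE p : p \is monic -> p = \prod_(z <- poly_roots p) ('X - z%:P).
Proof.
move=> /monicP p1; rewrite /poly_roots; case: closed_field_poly_normal => r /= {1}->.
by rewrite p1 scale1r.
Qed.

Lemma size_poly_roots p : p \is monic -> size (poly_roots p) = (size p).-1.
Proof. by move=> pm; rewrite [in RHS](poly_rootsE pm) size_prod_XsubC. Qed.

(** The real parts of the complex roots, with multiplicity. *)
Definition real_roots p : seq R := [seq complex.Re z | z <- poly_roots p].

Lemma real_roots_prod p : p \is monic -> (forall z, root p z -> complex.Im z = 0) ->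
  p = \prod_(x <- real_roots p) ('X - (x%:C)%:P).
Proof.
move=> pm pR; rewrite {1}(poly_rootsE pm) big_map !big_seq; apply: eq_bigr => z zr.
have : root p z by rewrite (poly_rootsE pm) root_prod_XsubC.
by move=> /pR; case: z {zr} => x y /= ->.
Qed.

Lemma integral_root_distr p f : p \is monic -> bounded_measurable f ->
  (\int[root_distr p]_x (f x)%:E)%E = (avg (real_roots p) f)%:E.
Proof.
move=> pm bf; apply: (integral_from_nonneg (Phi := avg (real_roots p))) => //.
  move=> g [mg _] g0; rewrite /root_distr.
  have mg' : measurable_fun setT (fun x => (g x)%:E) by exact/measurable_EFinP.
  rewrite ge0_integral_mscale//; last by move=> x _; rewrite lee_fin.
  rewrite ge0_integral_measure_sum//; last by move=> x _; rewrite lee_fin.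
  under eq_bigr do rewrite integral_dirac// diracT mul1e.
  rewrite sumEFin -EFinM /avg /real_roots size_map size_poly_roots//; congr (_ * _)%:E.
  by rewrite big_map (big_nth 0) big_mkord size_poly_roots.
by move=> g h _ _; exact: avgB.
Qed.

End root_distribution.

Section symmetrization.
Variable R : realType.
Variable mu : probability R R.
Implicit Types f g : R -> R.

Lemma bounded_measurable_integrable f : bounded_measurable f ->
  mu.-integrable setT (EFin \o f).
Proof.
move=> [mf [C fC]]; apply: measurable_bounded_integrable => //.
- by apply: le_lt_trans (probability_le1 mu measurableT) _; rewrite ltry.
- exists C; split; first exact: num_real.
  by move=> t tC x _ /=; rewrite (le_trans (fC _))// ltW.
Qed.

Lemma bounded_measurable_comp f (u : R -> R) : bounded_measurable f ->
  measurable_fun setT u -> bounded_measurable (f \o u).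
Proof.
move=> [mf [C fC]] mu'; split; first exact: measurableT_comp.
by exists C => x; exact: fC.
Qed.

Lemma integral_symmetrization f : bounded_measurable f ->
  (\int[symmetrization mu]_x (f x)%:E)%E =
  (2^-1 * (\int[mu]_x f (sqrt_pos x) + \int[mu]_x f (sqrt_neg x)))%:E.
Proof.
move=> bf.
apply: (integral_from_nonneg (Phi := fun f =>
  2^-1 * (\int[mu]_x f (sqrt_pos x) + \int[mu]_x f (sqrt_neg x)))) => //.
  move=> g bg g0; have [mg [C gC]] := bg.
  have mg' : measurable_fun setT (fun x => (g x)%:E) by exact/measurable_EFinP.
  rewrite /symmetrization ge0_integral_mscale//; last by move=> x _; rewrite lee_fin.
  rewrite ge0_integral_measure_add//; last by move=> x _; rewrite lee_fin.
  rewrite !ge0_integral_distribution//; do ?by move=> x; rewrite lee_fin.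
  rewrite EFinM EFinD /Rintegral !fineK//.
    apply: integrable_fin_num => //; apply: bounded_measurable_integrable.
    exact: bounded_measurable_comp bg (@measurable_sqrt_neg R).
  apply: integrable_fin_num => //; apply: bounded_measurable_integrable.
  exact: bounded_measurable_comp bg (@measurable_sqrt_pos R).
move=> g h bg bh.
have ip k : bounded_measurable k ->
    mu.-integrable setT (EFin \o (fun x => k (sqrt_pos x))).
  move=> bk; apply: bounded_measurable_integrable.
  exact: bounded_measurable_comp bk (@measurable_sqrt_pos R).
have ing k : bounded_measurable k ->
    mu.-integrable setT (EFin \o (fun x => k (sqrt_neg x))).
  move=> bk; apply: bounded_measurable_integrable.
  exact: bounded_measurable_comp bk (@measurable_sqrt_neg R).
by rewrite !RintegralB//; [ring|exact: ing|exact: ing|exact: ip|exact: ip].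
Qed.

Lemma symmetrization_symmetric : symmetric_probability (symmetrization mu).
Proof.
have E A : symmetrization mu A =
    ((2^-1)%:E * (distribution mu (@sqrt_pos R) A + distribution mu (@sqrt_neg R) A))%E.
  by rewrite -measure_addE.
split.
  rewrite E !probability_setT.
  by rewrite -EFinD -EFinM; congr EFin; rewrite mulVf.
move=> A mA; rewrite !E; congr (_ * _)%E.
rewrite addeC; congr (_ + _)%E.
rewrite /distribution /pushforward/=; congr (mu _).
by apply/seteqP; split => x /=; rewrite /sqrt_neg /sqrt_pos opprK.
Qed.

End symmetrization.

(** * Moments of the limit measure and the theorem *)

Section rho_characterization.
Variable R : realType.
Variables (i j : nat) (A : 'I_i -> R) (B : 'I_j -> R) (c : nat -> R) (x0 K : R).
Hypothesis B0 : forall t, B t != 0.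
Hypothesis c_ge0 : forall k, 0 <= c k.
Hypothesis c0 : c 0 = 1.
Hypothesis c1 : 0 < c 1.
Hypothesis x0_gt0 : 0 < x0.
Hypothesis cK : forall n, (gseries c n).[x0] <= K.
Hypothesis cE : forall x, `|x| < x0 ->
  gsum c x * \prod_t (A t + gsum c x) =
  x * (1 + gsum c x) * \prod_t (B t + gsum c x).

(** A compactly supported measure with moments [c] has the prescribed
    S-transform. *)
Lemma moments_is_rho (mu : probability R R) (T : R) :
  mu `[0, T]%classic = 1%E -> (forall k, moment mu k = c k) -> is_rho B A mu.
Proof.
move=> muT muc; split; first by exists T.
  by rewrite muc; apply/eqP; rewrite gt_eqF.
exists (inverse_branch A B).
  have -> : moment_series mu = gsum c.
    apply/funext => z; rewrite /moment_series /gsum.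
    by under eq_fun do rewrite muc.
  exact: (gsum_inverse B0 c_ge0 c1 x0_gt0 cK cE).
have H : \forall z \near (0 : R), z != 0 ->
    \prod_(r < i) (z + A r) / \prod_(s < j) (z + B s) =
    (z + 1) / z * inverse_branch A B z.
  near=> z => z0.
  have z1 : z + 1 != 0.
    rewrite gt_eqF// -ltrBlDr sub0r; near: z; apply: lt_nbhsr; exact: ltrN10.
  by rewrite /inverse_branch mulrA [_ / z * _]mulrA divfK// mulfV// mul1r.
exact: H.
Unshelve. all: by end_near. Qed.

Lemma gseries_coef_bound k : c k * x0 ^+ k <= 1 + K.
Proof.
have K0 : 0 <= K.
  by apply: le_trans (cK 0); rewrite horner_gseries seriesEord/= big_ord0.
case: k => [|k]; first by rewrite c0 expr0 mulr1 lerDl.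
apply: (@le_trans _ _ K); last by rewrite lerDr.
apply: le_trans (cK k.+1); rewrite horner_gseries seriesEord/= big_ord_recr/= lerDr.
by apply: sumr_ge0 => l _; rewrite mulr_ge0// exprn_ge0// ltW.
Qed.

(** The prescribed S-transform determines the moments: two germs with the same
    local inverse agree, and so do their power series. *)
Lemma is_rho_moments (mu : probability R R) : is_rho B A mu ->
  forall k, moment mu k = c k.
Proof.
move=> [[T muT] _ [chi chi_inv chiS]].
have T0 := support_T_ge0 muT.
case=> [|k].
  rewrite c0 (moment_support muT); under eq_Rintegral do rewrite expr0.
  have e1 : fine (mu `[0, T]%classic) = 1 by rewrite muT.
  by rewrite Rintegral_cst// mul1r; exact: e1.
have E := inverse_near0_unique B0 c_ge0 x0_gt0 cK cE _ chi_inv chiS.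
have {}E : \forall x \near 0, moment_series mu x = gsum c x.
  by apply: E; exact: (gsum0 (moment mu)).
(* a common radius: T + 1 bounds the growth rate of the moments of mu *)
pose x1 := Num.min x0 (T + 1)^-1.
have T1 : 0 < T + 1 by rewrite ltr_wpDl.
have x1_gt0 : 0 < x1 by rewrite lt_min x0_gt0 invr_gt0.
have mb k' : `|moment mu k'| * x1 ^+ k' <= 2 + K.
  have K0 : 0 <= K.
  by apply: le_trans (cK 0); rewrite horner_gseries seriesEord/= big_ord0.
  apply: (@le_trans _ _ 1); last by move: K0; lra.
  apply: (@le_trans _ _ (T ^+ k' * (T + 1)^-1 ^+ k')).
    apply: ler_pM => //; first by rewrite exprn_ge0// ltW.
      exact: moment_bound.
    rewrite lerXn2r ?nnegrE ?(ltW x1_gt0)// ?invr_ge0 ?(ltW T1)//.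
    by rewrite ge_min lexx orbT.
  rewrite -exprMn exprn_ile1//; first by rewrite divr_ge0// ltW.
  by rewrite ler_pdivrMr// mul1r lerDl.
have cb k' : `|c k'| * x1 ^+ k' <= 1 + K.
  apply: le_trans (gseries_coef_bound k').
  rewrite ger0_norm// ler_wpM2l// lerXn2r ?nnegrE ?(ltW x1_gt0) ?(ltW x0_gt0)//.
  by rewrite ge_min lexx.
pose e k' := moment mu k' - c k'.
have eb k' : `|e k'| * x1 ^+ k' <= (2 + K) + (1 + K).
  apply: le_trans (lerD (mb k') (cb k')).
  rewrite -mulrDl ler_wpM2r ?exprn_ge0 ?(ltW x1_gt0)//.
  exact: ler_normB.
apply/eqP; rewrite -subr_eq0; apply/eqP; rewrite -/(e k.+1).
apply: (gsum_eq0 x1_gt0 eb) => //.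
near=> x.
have xx1 : `|x| <= x1 / 2.
  near: x; exists (x1 / 2); first by rewrite /= divr_gt0.
  by move=> y /=; rewrite sub0r normrN => /ltW.
have Ex : moment_series mu x = gsum c x by near: x.
have cm := cvg_bounded_coefs x1_gt0 mb xx1.
have cc := cvg_bounded_coefs x1_gt0 cb xx1.
have : [series e k.+1 * x ^+ k.+1]_k @ \oo --> moment_series mu x - gsum c x.
  rewrite (_ : [series e k.+1 * x ^+ k.+1]_k =
    [series moment mu k.+1 * x ^+ k.+1]_k - [series c k.+1 * x ^+ k.+1]_k); last first.
    apply/funext => n; rewrite /series/= !fctE -sumrB; apply: eq_bigr => l _.
    by rewrite /e mulrBl.
  exact: cvgB cm cc.
by rewrite Ex subrr => /cvg_lim; exact.
Unshelve. all: by end_near. Qed.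

End rho_characterization.

Section even_polynomials.
Variable R : realType.

(** The multiset of roots of an even polynomial is symmetric. *)
Lemma even_real_roots_opp (p : {poly R[i]}) (f : R -> R) n :
  even_real_rooted n.*2 p ->
  \sum_(x <- real_roots p) f (- x) = \sum_(x <- real_roots p) f x.
Proof.
move=> [pm ps pe pr].
pose zs := [seq x%:C | x <- real_roots p].
have pz : p = \prod_(z <- zs) ('X - z%:P) by rewrite big_map; exact: real_roots_prod.
have szs : size zs = n.*2 by rewrite !size_map size_poly_roots// ps.
have pN : p = \prod_(z <- zs) ('X + z%:P).
  rewrite -[LHS]pe pz (big_morph (fun q => q \Po (- 'X)) (fun q r => comp_polyM q r _)
    (comp_polyC 1 _)).
  transitivity (\prod_(z <- zs) - ('X + z%:P)).
    by apply: eq_bigr => z _ /=; rewrite comp_polyB comp_polyX comp_polyC; ring.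
  under eq_bigr do rewrite -mulN1r.
  rewrite big_split/= big_const_seq count_predT szs iter_mulr_1.
  by rewrite -signr_odd odd_double mul1r.
have : perm_eq zs [seq - z | z <- zs].
  apply: prod_XsubC_eq; rewrite -pz big_map {1}pN.
  by apply: eq_bigr => z _; rewrite polyCN opprK.
move=> /(perm_map (@complex.Re R)).
have -> : [seq complex.Re z | z <- zs] = real_roots p.
  by rewrite -map_comp -[RHS]map_id; apply: eq_map.
have -> : [seq complex.Re z | z <- [seq - z | z <- zs]] = [seq - x | x <- real_roots p].
  by rewrite -!map_comp; apply: eq_map.
move=> pR; rewrite [RHS](perm_big _ pR) /=.
by rewrite big_map.
Qed.

End even_polynomials.

Theorem theorem6p2 (R : realType) (i j : nat)
    (A : 'I_i -> R) (B : 'I_j -> R)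
    (hA : forall r, ~ (0 <= A r < 1)) (hB : forall s, B s <> 0)
    (a : nat -> 'I_i -> R) (b : nat -> 'I_j -> R) (p : nat -> {poly R[i]})
    (ha : forall m, (0 < m)%N -> admissible m (a m))
    (hp : forall m, (0 < m)%N ->
       p m = dil (Num.sqrt (m%:R ^ (i%:Z - j%:Z)))%:C (hyp_even_poly m (b m) (a m)))
    (hpR : forall m, (0 < m)%N -> even_real_rooted m.*2 (p m))
    (cvga : forall r, a m r @[m --> \oo] --> A r)
    (cvgb : forall s, b m s @[m --> \oo] --> B s) :
  (exists mu : probability R R, is_rho B A mu) /\
  (forall mu : probability R R, is_rho B A mu ->
     weak_cvg (fun m => root_distr (p m)) (symmetrization mu) /\
     symmetric_probability (symmetrization mu)).
Proof.
have A0 r : A r != 0 by apply/eqP => Ar; apply: (hA r); rewrite Ar lexx ltr01.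
have B0 s : B s != 0 by apply/eqP.
pose L m := [seq x ^+ 2 | x <- real_roots (p m)].
have sr m : (0 < m)%N -> size (real_roots (p m)) = m.*2.
  by move=> m0; have [pm ps _ _] := hpR m m0; rewrite size_map size_poly_roots// ps.
have L0 m : {in L m, forall x, 0 <= x} by move=> _ /mapP[x _ ->]; exact: sqr_ge0.
have Ls m : (m <= size (L m))%N.
  have [->//|m0] := posnP m; rewrite size_map sr// -addnn; exact: leq_addr.
pose mom m k := avg (L m) (fun x => x ^+ k).
have mom_eqn m n : (0 < m)%N ->
    eqXn n (twisted_ops (m%:R^-1) (- gseries (mom m) n) (fun t => a m t + m%:R^-1)
            (index_enum _) (- gseries (mom m) n))
         (- 'X * twisted_ops (m%:R^-1) (- gseries (mom m) n) (b m)
            (index_enum _) (1 + gseries (mom m) n)).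
  move=> m0; have [pm ps pe pr] := hpR m m0.
  have mr : (0 : R) < m%:R by rewrite ltr0n.
  pose gam : R := m%:R ^ (i%:Z - j%:Z).
  have gam_gt0 : 0 < gam by exact: exprz_gt0.
  have al0 : Num.sqrt gam != 0 by rewrite gt_eqF// sqrtr_gt0.
  have alE : Num.sqrt gam ^+ 2 * m%:R ^+ j = m%:R ^+ i :> R.
    rewrite sqr_sqrtr ?ltW// (exprnP _ j) (exprnP _ i) -expfzDr ?gt_eqF//.
    by rewrite subrK.
  have := @hyp_moments_equation R m i j (a m) (b m) m0 (Num.sqrt gam)
    (real_roots (p m)) (p m) al0 (hp m m0) (real_roots_prod pm pr) (sr m m0) pe
    (ha m m0) alE n.
  rewrite /= (_ : (fun k => _ * _) = mom m)//.
  by apply/funext => k; rewrite /mom /avg /L size_map sr// [in RHS]big_map.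
have [d [dcvg dE]] := moments_cvg A0 cvga cvgb mom_eqn.
(* the limit moments of order 0 included; [gseries] ignores the value at 0 *)
pose c k := if k is 0 then 1 else d k.
have gc n : gseries c n = gseries d n.
  by apply/polyP => k; rewrite !coef_poly; case: k.
have Lc k : avg (L m) (fun x => x ^+ k) @[m --> \oo] --> c k.
  case: k => [|k]; last exact: dcvg.
  apply: (@cvg_trans _ ((fun=> 1 : R) @ \oo)); last exact: cvg_cst.
  apply: near_eq_cvg; near=> m.
  rewrite /= avg_cst//; apply: leq_trans (Ls m).
  by near: m; exact: nbhs_infty_gt.
have c_ge0 k : 0 <= c k.
  have zc : (fun=> 0 : R) @ \oo --> (0 : R) by exact: cvg_cst.
  apply: (ler_cvg_to zc (Lc k)); near=> m.
  by rewrite mulr_ge0 ?invr_ge0// big_seq sumr_ge0// => x /L0 xL; rewrite exprn_ge0.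
have cE n : let T := gseries c n in
    eqXn n (T * \prod_t ((A t)%:P + T)) ('X * (1 + T) * \prod_t ((B t)%:P + T)).
  by rewrite /= gc; exact: dE.
have c1 : 0 < c 1.
  rewrite lt_neqAle c_ge0 andbT eq_sym; apply/eqP => c10.
  have := cE 1 1 (leqnn 1).
  (* the equation at order 1 reads c 1 * prod A = prod B, which is nonzero *)
  have T0 : gseries c 1 = 0.
    apply/polyP => k; rewrite coef0 coef_poly.
    by case: k => [|[|k]]//=.
  rewrite T0 mul0r addr0 mulr1 coef0 coefXM/=.
  under eq_bigr do rewrite addr0.
  rewrite -rmorph_prod coefC/= => /esym/eqP; apply/negP.
  by apply/prodf_neq0 => s _; exact: B0.
have [x0 [K [x0_gt0 K_gt0 cK]]] := gseries_bounded A0 c_ge0 cE.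
have cEx x : `|x| < x0 -> gsum c x * \prod_t (A t + gsum c x) =
    x * (1 + gsum c x) * \prod_t (B t + gsum c x).
  exact: (gsum_equation c_ge0 cE x0_gt0 cK).
have cK' := gseries_coef_bound c_ge0 (erefl : c 0 = 1) x0_gt0 cK.
split.
  have T_gt0 : 0 < 2 / x0 by rewrite divr_gt0.
  have Tx0 : 2 <= 2 / x0 * x0 by rewrite divfK// gt_eqF.
  have [mu [muT muc]] := probability_with_moments L0 Ls Lc x0_gt0 cK' T_gt0 Tx0.
  by exists mu; exact: (moments_is_rho B0 c_ge0 c1 x0_gt0 cK cEx muT muc).
move=> mu mu_rho; split; last exact: symmetrization_symmetric.
have muc := is_rho_moments B0 c_ge0 (erefl : c 0 = 1) x0_gt0 cK cEx mu_rho.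
have [[T muT] _ _] := mu_rho.
move=> f fc [H fH].
have bf : bounded_measurable f.
  by split; [exact: continuous_measurable_fun|exists H].
rewrite integral_symmetrization//.
(* the test function transported to the squares of the roots *)
pose h t := 2^-1 * (f (sqrt_pos t) + f (sqrt_neg t)).
have cp : continuous (fun t => f (sqrt_pos t)).
  by move=> t; apply: continuous_comp; [exact: sqrt_continuous|exact: fc].
have cn : continuous (fun t => f (sqrt_neg t)).
  move=> t; apply: continuous_comp; last exact: fc.
  by apply: cvgN; exact: sqrt_continuous.
have hc : continuous h.
  by move=> t; apply: cvgM; [exact: cvg_cst|apply: cvgD; [exact: cp|exact: cn]].
have hH t : `|h t| <= H.
  rewrite /h normrM gtr0_norm ?invr_gt0// ler_pdivrMl//.
  apply: le_trans (ler_normD _ _) _.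
  by have := fH (sqrt_pos t); have := fH (sqrt_neg t); lra.
have hI : \int[mu]_t h t =
    2^-1 * (\int[mu]_x f (sqrt_pos x) + \int[mu]_x f (sqrt_neg x)).
  have bp := bounded_measurable_comp bf (@measurable_sqrt_pos R).
  have bn := bounded_measurable_comp bf (@measurable_sqrt_neg R).
  rewrite /h RintegralZl//; last first.
    apply: bounded_measurable_integrable; split.
      by apply: measurable_funD; [have [] := bp|have [] := bn].
    exists (H + H) => t; apply: le_trans (ler_normD _ _) _.
    exact: lerD.
  by rewrite RintegralD//; exact: bounded_measurable_integrable.
rewrite -hI.
have H1 := avg_weak_cvg L0 Ls Lc x0_gt0 cK' muT muc hc hH.
apply: (@cvg_trans _ ((fun m => (avg (L m) h)%:E) @ \oo)); last first.
  by apply: cvg_EFin; [exact: nearW|exact: H1].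
apply: near_eq_cvg; near=> m.
have m0 : (0 < m)%N by near: m; exact: nbhs_infty_gt.
have [pm _ _ _] := hpR m m0.
rewrite integral_root_distr//; congr EFin.
rewrite /avg size_map; congr (_ * _); rewrite big_map.
have hsq x : h (x ^+ 2) = 2^-1 * (f x + f (- x)).
  rewrite /h /sqrt_pos /sqrt_neg sqrtr_sqr; congr (_ * _).
  have [x0'|/ltW x0'] := leP 0 x; first by rewrite ger0_norm.
  by rewrite ler0_norm// opprK addrC.
under eq_bigr do rewrite hsq.
rewrite -mulr_sumr big_split/= (even_real_roots_opp _ (hpR m m0)).
by rewrite mulrDr ![2^-1 * _]mulrC -splitr.
Unshelve. all: by end_near. Qed.
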